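(* Let $M$ be a quaternion manifold. Then there exists a tangent bundle $TM$ which has the structure of a quaternion manifold such that each fibre $T_xM$, $x\in M$, is a vector space over $\mathbf H$.
   Context: $\mathbf H$ denotes the quaternion skew field with real basis $i_0=1,i_1=i,i_2=j,i_3=k$; $\tilde z=z^*$ is the conjugate of $z$. A vector space over $\mathbf H$ is an additive group that is a left and a right $\mathbf H$-module with the corresponding associativity and distributivity laws; $l_2(\mathbf H)$ is the space of sequences $x=(x_n)$ in $\mathbf H$ with $\|x\|^2=\sum_n x_nx_n^*<\infty$. A map $f$ between open subsets of such spaces is quaternion holomorphic (written $\tilde\partial f=0$) if it is superdifferentiable in $z$ with no dependence on $\tilde z$, i.e. it is locally $z$-analytic: near each point it is given by a convergent power series whose terms are sums of noncommutative monomials $a_1z_{s_1}a_2z_{s_2}\cdots z_{s_p}a_{p+1}$ in the (centred) coordinates $z_s$ with quaternion coefficients. Its superdifferential is its Fréchet derivative, which is real-linear but is not required to be left or right $\mathbf H$-linear. A quaternion manifold is a metric separable space $M$ with an at most countable atlas $\{(U_j,\phi_j)\}$, $\bigcup_jU_j=M$, where $\phi_j:U_j\to\phi_j(U_j)\subset X$ are homeomorphisms onto $C^\infty$-domains of $X=\mathbf H^n$ or $X=l_2(\mathbf H)$, and the transition maps $\phi_j\circ\phi_m^{-1}$ are quaternion biholomorphic (for $l_2(\mathbf H)$ also Fréchet $C^\infty$). *)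

(* Defs.v *)
From HB Require Import structures.
From mathcomp Require Import all_boot all_order all_algebra.
From mathcomp Require Import all_classical all_reals all_analysis.
From mathcomp Require Import ring lra.

Set Implicit Arguments.
Unset Strict Implicit.
Unset Printing Implicit Defensive.

Import Order.TTheory GRing.Theory Num.Theory.
Import numFieldNormedType.Exports.

Local Open Scope classical_set_scope.
Local Open Scope ring_scope.

Record quat (R : Type) := Quat { qre : R; qi : R; qj : R; qk : R }.

Section QuatRing.
Variable R : realType.
Implicit Types x y z : quat R.

Definition quat_tuple z := (qre z, qi z, qj z, qk z).
Definition tuple_quat (t : R * R * R * R) :=
  Quat t.1.1.1 t.1.1.2 t.1.2 t.2.
Lemma quat_tupleK : cancel quat_tuple tuple_quat. Proof. by case. Qed.
HB.instance Definition _ := Choice.copy (quat R) (can_type quat_tupleK).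

Definition addq x y :=
  Quat (qre x + qre y) (qi x + qi y) (qj x + qj y) (qk x + qk y).
Definition oppq x := Quat (- qre x) (- qi x) (- qj x) (- qk x).
Definition qreal (r : R) : quat R := Quat r 0 0 0.
Definition mulq x y := Quat
  (qre x * qre y - qi x * qi y - qj x * qj y - qk x * qk y)
  (qre x * qi y + qi x * qre y + qj x * qk y - qk x * qj y)
  (qre x * qj y - qi x * qk y + qj x * qre y + qk x * qi y)
  (qre x * qk y + qi x * qj y - qj x * qi y + qk x * qre y).
Definition scaleq (r : R) x := Quat (r * qre x) (r * qi x) (r * qj x) (r * qk x).

Lemma addqA : associative addq.
Proof. by move=> [????] [????] [????]; congr Quat => /=; ring. Qed.
Lemma addqC : commutative addq.
Proof. by move=> [????] [????]; congr Quat => /=; ring. Qed.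
Lemma add0q : left_id (qreal 0) addq.
Proof. by move=> [????]; congr Quat => /=; ring. Qed.
Lemma addNq : left_inverse (qreal 0) oppq addq.
Proof. by move=> [????]; congr Quat => /=; ring. Qed.
HB.instance Definition _ := GRing.isZmodule.Build (quat R) addqA addqC add0q addNq.

Lemma mulqA : associative mulq.
Proof. by move=> [????] [????] [????]; congr Quat => /=; ring. Qed.
Lemma mul1q : left_id (qreal 1) mulq.
Proof. by move=> [????]; congr Quat => /=; ring. Qed.
Lemma mulq1 : right_id (qreal 1) mulq.
Proof. by move=> [????]; congr Quat => /=; ring. Qed.
Lemma mulqDl : left_distributive mulq +%R.
Proof. by move=> [????] [????] [????]; congr Quat => /=; ring. Qed.
Lemma mulqDr : right_distributive mulq +%R.
Proof. by move=> [????] [????] [????]; congr Quat => /=; ring. Qed.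
Lemma qreal1_neq0 : qreal 1 != 0 :> quat R.
Proof. by apply/eqP => -[] /eqP; rewrite oner_eq0. Qed.
HB.instance Definition _ := GRing.Zmodule_isNzRing.Build (quat R)
  mulqA mul1q mulq1 mulqDl mulqDr qreal1_neq0.

Lemma scaleqA r s x : scaleq r (scaleq s x) = scaleq (r * s) x.
Proof. by case: x => ????; congr Quat => /=; ring. Qed.
Lemma scale1q : left_id 1 scaleq.
Proof. by move=> [????]; congr Quat => /=; ring. Qed.
Lemma scaleqDr : right_distributive scaleq +%R.
Proof. by move=> r [????] [????]; congr Quat => /=; ring. Qed.
Lemma scaleqDl x : {morph scaleq^~ x : r s / r + s}.
Proof. by move=> r s; case: x => ????; congr Quat => /=; ring. Qed.
HB.instance Definition _ := GRing.Zmodule_isLmodule.Build R (quat R)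
  scaleqA scale1q scaleqDr scaleqDl.

Definition qconj z := Quat (qre z) (- qi z) (- qj z) (- qk z).

Definition qnormsq z : R := qre (z * qconj z).

Lemma mulq_conj z : z * qconj z = qreal (qnormsq z).
Proof. by case: z => ????; congr Quat => /=; ring. Qed.

Lemma qnormsqE z : qnormsq z = qre z ^+ 2 + qi z ^+ 2 + qj z ^+ 2 + qk z ^+ 2.
Proof. by rewrite /qnormsq /=; ring. Qed.

Lemma qnormsq_ge0 z : 0 <= qnormsq z.
Proof. by rewrite qnormsqE !addr_ge0 ?sqr_ge0. Qed.

Lemma qnormsqD (t : R) x y : 0 < t ->
  qnormsq (x + y) <= (1 + t) * qnormsq x + (1 + t^-1) * qnormsq y.
Proof.
move=> t0; rewrite !qnormsqE /=.
have H (a b : R) : (a + b) ^+ 2 <= (1 + t) * a ^+ 2 + (1 + t^-1) * b ^+ 2.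
  rewrite -subr_ge0.
  have -> : (1 + t) * a ^+ 2 + (1 + t^-1) * b ^+ 2 - (a + b) ^+ 2
    = t^-1 * (t * a - b) ^+ 2 by field; rewrite gt_eqF.
  by rewrite mulr_ge0 ?sqr_ge0 // invr_ge0 ltW.
have := H (qre x) (qre y); have := H (qi x) (qi y).
have := H (qj x) (qj y); have := H (qk x) (qk y); lra.
Qed.

Lemma sqrt_triangle (s a b : R) : 0 <= a -> 0 <= b ->
  (forall t, 0 < t -> s <= (1 + t) * a + (1 + t^-1) * b) ->
  Num.sqrt s <= Num.sqrt a + Num.sqrt b.
Proof.
move=> a0 b0 H; apply/ler_addgt0Pr => e e0.
set u := Num.sqrt a; set v := Num.sqrt b.
have u0 : 0 <= u by exact: sqrtr_ge0.
have v0 : 0 <= v by exact: sqrtr_ge0.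
have eu : a = u ^+ 2 by rewrite sqr_sqrtr.
have ev : b = v ^+ 2 by rewrite sqr_sqrtr.
pose d := e / 2; have d0 : 0 < d by rewrite divr_gt0.
have ud : 0 < u + d by rewrite ltr_wpDl.
have vd : 0 < v + d by rewrite ltr_wpDl.
have -> : u + v + e = (u + d) + (v + d) by rewrite /d; field.
rewrite -(ger0_norm (ltW (addr_gt0 ud vd))) -sqrtr_sqr ler_wsqrtr//.
apply: le_trans (H ((v + d) / (u + d)) (divr_gt0 vd ud)) _.
rewrite invf_div eu ev.
have -> : (1 + (v + d) / (u + d)) * u ^+ 2 + (1 + (u + d) / (v + d)) * v ^+ 2
  = ((u + d) + (v + d)) * (u ^+ 2 / (u + d) + v ^+ 2 / (v + d)).
  by field; rewrite !gt_eqF.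
rewrite [leRHS]expr2 ler_wpM2l ?(ltW (addr_gt0 ud vd))//.
by rewrite lerD// ler_pdivrMr// -expr2 ler_sqr ?nnegrE ?lerDl ?(ltW d0)// ?ltW.
Qed.

Definition qnorm z := Num.sqrt (qnormsq z).

Lemma qnormD x y : qnorm (x + y) <= qnorm x + qnorm y.
Proof.
by apply: sqrt_triangle; rewrite ?qnormsq_ge0// => t; exact: qnormsqD.
Qed.
Lemma qnormZ (r : R) x : qnorm (r *: x) = `|r| * qnorm x.
Proof.
rewrite /qnorm -sqrtr_sqr -sqrtrM ?sqr_ge0//; congr Num.sqrt.
by rewrite !qnormsqE /=; ring.
Qed.
Lemma qnorm0_eq0 x : qnorm x = 0 -> x = 0.
Proof.
move=> /eqP; rewrite sqrtr_eq0 => nx.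
have : qnormsq x = 0 by apply/eqP; rewrite eq_le nx qnormsq_ge0.
rewrite qnormsqE => /eqP; rewrite !paddr_eq0 ?addr_ge0 ?sqr_ge0//.
rewrite !sqrf_eq0 -!andbA => /and4P[/eqP a /eqP b /eqP c /eqP d].
by case: x a b c d {nx} => ???? /= -> -> -> ->.
Qed.
HB.instance Definition _ := Lmodule_isNormed.Build R (quat R)
  qnormD qnormZ qnorm0_eq0.

Lemma qnorm_sq x : `|x| ^+ 2 = qnormsq x.
Proof. by rewrite sqr_sqrtr// qnormsq_ge0. Qed.

End QuatRing.

(** The vector spaces over H are the [bimodType (quat R)]: left and right
    H-modules on one additive group, with commuting actions. *)

HB.mixin Record Lmodule_isBimodule (A : nzRingType) V & GRing.Lmodule A V := {
  rscale : V -> A -> V;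
  rscaleA : forall v a b, rscale (rscale v a) b = rscale v (a * b);
  rscale1 : forall v, rscale v 1 = v;
  rscaleDl : forall u v a, rscale (u + v) a = rscale u a + rscale v a;
  rscaleDr : forall v a b, rscale v (a + b) = rscale v a + rscale v b;
  scaleA_rscale : forall a v b, a *: rscale v b = rscale (a *: v) b
}.

#[short(type="bimodType")]
HB.structure Definition Bimodule (A : nzRingType) :=
  { V of GRing.Lmodule A V & Lmodule_isBimodule A V }.

Section Ell2.
Variables (R : realType) (I : choiceType).

Record ell2 := Ell2 {
  coord :> I -> quat R;
  coord_summable : (\esum_(i in [set: I]) (`|coord i| ^+ 2)%:E < +oo)%E }.

Implicit Types x y z : ell2.

Lemma ell2P x y : coord x =1 coord y -> x = y.
Proof.
case: x y => [x sx] [y sy] /= /funext exy; rewrite {}exy in sx *.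
by congr Ell2; exact: Prop_irrelevance.
Qed.

HB.instance Definition _ := gen_eqMixin ell2.
HB.instance Definition _ := gen_choiceMixin ell2.

Definition ell2_sum (x : I -> quat R) : \bar R :=
  \esum_(i in [set: I]) (`|x i| ^+ 2)%:E.

Lemma ell2_sum_ge0 (x : I -> quat R) : (0 <= ell2_sum x)%E.
Proof. by apply: esum_ge0 => i _; rewrite lee_fin sqr_ge0. Qed.

Lemma esumZ (c : R) (f : I -> R) : 0 <= c -> (forall i, 0 <= f i) ->
  (\esum_(i in [set: I]) (c * f i)%:E
   <= c%:E * \esum_(i in [set: I]) (f i)%:E)%E.
Proof.
move=> c0 f0; apply: ge_ereal_sup => _ [A [fA _]] <-.
under eq_fsbigr do rewrite EFinM.
rewrite -ge0_mule_fsumr; last by move=> i; rewrite lee_fin.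
rewrite lee_wpmul2l ?lee_fin//; apply: ereal_sup_ubound.
by exists A.
Qed.

Lemma ell2_sumD (t : R) (x y : I -> quat R) : 0 < t ->
  (ell2_sum (fun i => x i + y i)%R
   <= (1 + t)%:E * ell2_sum x + (1 + t^-1)%:E * ell2_sum y)%E.
Proof.
move=> t0; have t1 : 0 <= 1 + t by rewrite addr_ge0 ?ltW.
have t2 : 0 <= 1 + t^-1 by rewrite addr_ge0 ?invr_ge0 ?ltW.
apply: (@le_trans _ _ (\esum_(i in [set: I])
    (((1 + t) * `|x i| ^+ 2)%:E + ((1 + t^-1) * `|y i| ^+ 2)%:E)%E)).
  apply: le_esum => i _.
  by rewrite -EFinD lee_fin !qnorm_sq; exact: qnormsqD.
rewrite esumD; first last.
- by move=> i _; rewrite lee_fin mulr_ge0 ?sqr_ge0.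
- by move=> i _; rewrite lee_fin mulr_ge0 ?sqr_ge0.
by rewrite leeD// esumZ// => i; rewrite sqr_ge0.
Qed.

Lemma ell2_sumZ (c : R) (x : I -> quat R) :
  (ell2_sum (fun i => c *: x i)%R <= (c ^+ 2)%:E * ell2_sum x)%E.
Proof.
rewrite /ell2_sum.
under eq_esum do rewrite normrZ exprMn real_normK ?num_real//.
by apply: esumZ; rewrite ?sqr_ge0// => i; rewrite sqr_ge0.
Qed.

Lemma ell2_fin x : ell2_sum x \is a fin_num.
Proof. by rewrite ge0_fin_numE ?ell2_sum_ge0//; exact: coord_summable. Qed.

Lemma add_summable x y : (ell2_sum (fun i => coord x i + coord y i)%R < +oo)%E.
Proof.
apply: le_lt_trans (ell2_sumD _ _ ltr01) _.
by rewrite -(fineK (ell2_fin x)) -(fineK (ell2_fin y)) -!EFinM -EFinD ltry.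
Qed.
Lemma scale_summable c x : (ell2_sum (fun i => c *: coord x i)%R < +oo)%E.
Proof.
apply: le_lt_trans (ell2_sumZ _ _) _.
by rewrite -(fineK (ell2_fin x)) -EFinM ltry.
Qed.
Lemma zero_summable : (ell2_sum (fun _ => 0%R) < +oo)%E.
Proof. by rewrite /ell2_sum esum1 ?ltry// => i _; rewrite normr0 expr0n. Qed.
Lemma opp_summable x : (ell2_sum (fun i => - coord x i)%R < +oo)%E.
Proof.
by rewrite /ell2_sum; under eq_esum do rewrite normrN; exact: coord_summable.
Qed.

Definition ell2_zero := Ell2 zero_summable.
Definition ell2_add x y := Ell2 (add_summable x y).
Definition ell2_opp x := Ell2 (opp_summable x).
Definition ell2_scale c x := Ell2 (scale_summable c x).

Lemma ell2_addA : associative ell2_add.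
Proof. by move=> x y z; apply: ell2P => i /=; rewrite addrA. Qed.
Lemma ell2_addC : commutative ell2_add.
Proof. by move=> x y; apply: ell2P => i /=; rewrite addrC. Qed.
Lemma ell2_add0 : left_id ell2_zero ell2_add.
Proof. by move=> x; apply: ell2P => i /=; rewrite add0r. Qed.
Lemma ell2_addN : left_inverse ell2_zero ell2_opp ell2_add.
Proof. by move=> x; apply: ell2P => i /=; rewrite addNr. Qed.
HB.instance Definition _ :=
  GRing.isZmodule.Build ell2 ell2_addA ell2_addC ell2_add0 ell2_addN.

Lemma ell2_scaleA a b x : ell2_scale a (ell2_scale b x) = ell2_scale (a * b) x.
Proof. by apply: ell2P => i /=; rewrite scalerA. Qed.
Lemma ell2_scale1 : left_id 1 ell2_scale.
Proof. by move=> x; apply: ell2P => i /=; rewrite scale1r. Qed.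
Lemma ell2_scaleDr : right_distributive ell2_scale +%R.
Proof. by move=> a x y; apply: ell2P => i /=; rewrite scalerDr. Qed.
Lemma ell2_scaleDl x : {morph ell2_scale^~ x : a b / a + b}.
Proof. by move=> a b; apply: ell2P => i /=; rewrite scalerDl. Qed.
HB.instance Definition _ := GRing.Zmodule_isLmodule.Build R ell2
  ell2_scaleA ell2_scale1 ell2_scaleDr ell2_scaleDl.

Definition ell2_norm x := Num.sqrt (fine (ell2_sum x)).

Lemma ell2_normD x y : ell2_norm (x + y) <= ell2_norm x + ell2_norm y.
Proof.
apply: sqrt_triangle; rewrite ?fine_ge0 ?ell2_sum_ge0// => t t0.
rewrite -lee_fin EFinD !EFinM !fineK ?ell2_fin//.
exact: ell2_sumD.
Qed.
Lemma ell2_norm0_eq0 x : ell2_norm x = 0 -> x = 0.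
Proof.
move=> /eqP; rewrite sqrtr_eq0 => nx; apply: ell2P => i /=.
apply/eqP; rewrite -normr_eq0 -sqrf_eq0 eq_le sqr_ge0 andbT.
apply: le_trans nx; rewrite -lee_fin fineK ?ell2_fin//.
apply: esum_ge; exists [set i]; first by split.
by rewrite fsbig_set1.
Qed.
Lemma ell2_normZ_le (c : R) x : ell2_norm (c *: x) <= `|c| * ell2_norm x.
Proof.
rewrite /ell2_norm -sqrtr_sqr -sqrtrM ?sqr_ge0// ler_wsqrtr//.
by rewrite -lee_fin EFinM !fineK ?ell2_fin//; exact: ell2_sumZ.
Qed.
Lemma ell2_normZ (c : R) x : ell2_norm (c *: x) = `|c| * ell2_norm x.
Proof.
apply/eqP; rewrite eq_le ell2_normZ_le /=.
have [->|c0] := eqVneq c 0; first by rewrite normr0 mul0r sqrtr_ge0.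
rewrite -ler_pdivlMl ?normr_gt0// -normfV -[in leLHS](scale1r x).
by rewrite -(mulVf c0) -scalerA ell2_normZ_le.
Qed.
HB.instance Definition _ := Lmodule_isNormed.Build R ell2
  ell2_normD ell2_normZ ell2_norm0_eq0.

End Ell2.

(** [H^n] is the space of square-summable families on ['I_n], that is, of all
    families, with the Euclidean norm. *)

Inductive model := Hn of nat | l2H.

Definition coords (d : model) : countType :=
  match d with Hn n => 'I_n | l2H => nat end.

Definition qspace (R : realType) (d : model) := ell2 R (coords d).

(** The model of the tangent bundle: [H^n * H^n = H^(n + n)], and
    [l_2(H) * l_2(H)] is [l_2(H)], even coordinates coming first. *)
Definition tangent_model (d : model) : model :=
  match d with Hn n => Hn (n + n) | l2H => l2H end.

Definition base_coord (d : model) : coords d -> coords (tangent_model d) :=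
  match d return coords d -> coords (tangent_model d) with
  | Hn n => @lshift n n
  | l2H => fun i => i.*2
  end.

Definition vect_coord (d : model) : coords d -> coords (tangent_model d) :=
  match d return coords d -> coords (tangent_model d) with
  | Hn n => @rshift n n
  | l2H => fun i => i.*2.+1
  end.

Lemma base_coord_inj d : injective (@base_coord d).
Proof. by case: d => [n|] /=; [exact: lshift_inj|exact: double_inj]. Qed.

Lemma vect_coord_inj d : injective (@vect_coord d).
Proof.
case: d => [n|] /=; first exact: rshift_inj.
by move=> i j [] /double_inj.
Qed.

Lemma reindex_summable (R : realType) (I J : choiceType) (f : I -> J)
    (fI : injective f) (z : ell2 R J) : (ell2_sum (coord z \o f) < +oo)%E.
Proof.
apply: le_lt_trans (coord_summable z).
apply: ge_ereal_sup => _ [A [fA _]] <-.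
apply: esum_ge; exists (f @` A); first by split => //; exact: finite_image.
rewrite (@reindex_fsbig _ _ _ _ _ f A (f @` A))//=.
by split=> [i Ai | x y _ _ |//]; [exists i | exact: fI].
Qed.

Definition base_part (R : realType) (d : model)
    (z : qspace R (tangent_model d)) : qspace R d :=
  Ell2 (reindex_summable (@base_coord_inj d) z).

Definition vect_part (R : realType) (d : model)
    (z : qspace R (tangent_model d)) : qspace R d :=
  Ell2 (reindex_summable (@vect_coord_inj d) z).

Section Holomorphic.
Variables (R : realType) (I J : choiceType).
Implicit Types (U : set (ell2 R I)) (z : ell2 R I).

(** [a_1 z_(s_1) a_2 z_(s_2) ... z_(s_p) a_(p+1)]; the list holds the pairs
    [(s_i, a_(i+1))], and the product is the ordered one. *)
Definition qmonomial (m : quat R * seq (I * quat R)) z : quat R :=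
  m.1 * \prod_(s <- m.2) (z s.1 * s.2).

(** Every component is a convergent series of monomials of degree [p] (in
    [l_2(H)] infinitely many monomials are needed). *)
Definition qhomogeneous (p : nat) (P : ell2 R I -> ell2 R J) : Prop :=
  forall k : J, exists m : nat -> quat R * seq (I * quat R),
    (forall n, size (m n).2 = p) /\
    (forall z, series (fun n => qmonomial (m n) z) @ \oo --> (P z : ell2 R J) k).

(** Near [zeta], [f] is the sum of a power series in the centred variable,
    converging normally on a ball. *)
Definition qanalytic_at (f : ell2 R I -> ell2 R J) (zeta : ell2 R I) : Prop :=
  exists (r : R) (P : nat -> ell2 R I -> ell2 R J) (b : nat -> R),
    [/\ 0 < r,
        forall p, qhomogeneous p (P p),
        forall p z, `|z| < r -> `|P p z| <= b p,
        cvgn (series b) &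
        forall z, `|z| < r -> series (fun p => P p z) @ \oo --> f (zeta + z)].

Definition qholomorphic U (f : ell2 R I -> ell2 R J) : Prop :=
  forall zeta, U zeta -> qanalytic_at f zeta.

End Holomorphic.

Section Smooth.
Variables (R : realType) (V W : normedModType R).

(** For [s] of size [k], [D x s] is the [k]-th Frechet derivative at [x]
    evaluated at the vectors of [s]: it is a bounded [k]-linear map, and
    [D _ (h :: _)] is the derivative in the direction [h] of the [k]-th one for
    the norm of bounded [k]-linear maps. *)
Definition frechet_smooth (U : set V) (f : V -> W) : Prop :=
  exists D : V -> seq V -> W, forall x, U x ->
    [/\ D x [::] = f x,
        forall s t a u v,
          D x (s ++ (a *: u + v) :: t) = a *: D x (s ++ u :: t) + D x (s ++ v :: t),
        forall k, exists C : R, forall s, size s = k ->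
          `|D x s| <= C * \prod_(v <- s) `|v| &
        forall k (e : R), 0 < e -> \forall h \near (0 : V),
          forall s, size s = k ->
          `|D (x + h) s - D x s - D x (h :: s)| <= e * `|h| * \prod_(v <- s) `|v|].

End Smooth.

(** A nonempty connected open set whose boundary is locally a [C^oo]
    hypersurface [rho = 0], the set lying on the side [rho < 0]. *)
Definition smooth_domain (R : realType) (V : normedModType R) (O : set V) : Prop :=
  [/\ O !=set0, open O, connected O &
      forall p, closure O p -> ~ O p ->
      exists (W : set V) (rho : V -> R^o),
        [/\ open W, W p, frechet_smooth W rho,
            exists h, 'd rho p h != 0 &
            O `&` W = [set x | W x /\ rho x < 0]]].

Section Manifold.
Variables (R : realType).

(** A chart [U -> X], with its inverse; both are total functions that only
    matter on [U] and on the image of [U]. *)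
Record qchart (M : Type) (d : model) := QChart {
  chart_dom : set M;
  chart_map : M -> qspace R d;
  chart_inv : qspace R d -> M }.

Definition chart_img M d (c : qchart M d) : set (qspace R d) :=
  chart_map c @` chart_dom c.

Definition is_qchart (M : metricType R) d (c : qchart M d) : Prop :=
  [/\ open (chart_dom c), smooth_domain (chart_img c),
      {in chart_dom c, cancel (chart_map c) (chart_inv c)},
      {within chart_dom c, continuous (chart_map c)} &
      {within chart_img c, continuous (chart_inv c)}].

Definition transition M d (c c' : qchart M d) : qspace R d -> qspace R d :=
  chart_map c' \o chart_inv c.

Definition overlap M d (c c' : qchart M d) : set (qspace R d) :=
  chart_map c @` (chart_dom c `&` chart_dom c').

Definition holomorphic_map d (U : set (qspace R d))
    (f : qspace R d -> qspace R d) : Prop :=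
  qholomorphic U f /\ (d = l2H -> frechet_smooth U f).

Definition biholomorphic d (U V : set (qspace R d))
    (f g : qspace R d -> qspace R d) : Prop :=
  [/\ f @` U = V, {in U, cancel f g}, holomorphic_map U f & holomorphic_map V g].

Definition quaternion_manifold (M : metricType R) d (J : countType)
    (c : J -> qchart M d) : Prop :=
  [/\ exists2 A : set M, countable A & dense A,
      \bigcup_j chart_dom (c j) = [set: M],
      forall j, is_qchart (c j) &
      forall j m, biholomorphic (overlap (c j) (c m)) (overlap (c m) (c j))
        (transition (c j) (c m)) (transition (c m) (c j))].

(** [T x] is the fibre over [x], embedded by [iota x] in the total space [TM]
    with projection [proj]; [tc] is the atlas of [TM] induced by the atlas [c]. *)
Record tangent_bundle (M : metricType R) d (J : countType) (c : J -> qchart M d)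
    (T : M -> bimodType (quat R)) (TM : metricType R) (proj : TM -> M)
    (iota : forall x, T x -> TM) (tc : J -> qchart TM (tangent_model d))
    (fibre := fun j x (v : T x) => vect_part (chart_map (tc j) (iota x v))) :
    Prop := {
  tb_iota_inj : forall x, injective (iota x);
  tb_iota_fibre : forall x, range (iota x) = proj @^-1` [set x];
  tb_dom : forall j, chart_dom (tc j) = proj @^-1` chart_dom (c j);
  tb_base : forall j x v, chart_dom (c j) x ->
    base_part (chart_map (tc j) (iota x v)) = chart_map (c j) x;
  tb_bij : forall j x, chart_dom (c j) x -> bijective (fibre j x);
  (* every chart is real linear on the fibres *)
  tb_add : forall j x u v, chart_dom (c j) x ->
    fibre j x (u + v) = fibre j x u + fibre j x v;
  tb_scale : forall j x (r : R) v, chart_dom (c j) x ->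
    fibre j x (qreal r *: v) = r *: fibre j x v;
  (* the fibres are glued by the Frechet derivatives of the transition maps *)
  tb_cocycle : forall j m x v, chart_dom (c j) x -> chart_dom (c m) x ->
    fibre m x v = 'd (transition (c j) (c m)) (chart_map (c j) x) (fibre j x v);
  (* These derivatives are only real linear, so that the quaternion structure
     of the model space can be read in a suitable chart at [x], not in all. *)
  tb_quat : forall x, exists2 j, chart_dom (c j) x &
    forall (a b : quat R) v i,
      fibre j x (a *: v) i = a * fibre j x v i /\
      fibre j x (rscale v b) i = fibre j x v i * b }.

End Manifold.

(* Main.v *)
(** As a set, [TM] is [M * X]: a tangent vector at [x] is stored by its
    coordinate in a chart chosen at [x], and it is carried to any other chart by
    the differential of the transition map. The transition maps of [TM] are then
    the tangent maps [(x, v) |-> (f x, 'd f x v)] of those of [M].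

    These are holomorphic: if [f (zeta + z) = \sum_p P_p z], then
    ['d f (zeta + z) h = \sum_p DP_p z h], where [DP_p z h] is the coefficient of
    [t] in the polynomial [P_p (z + t h)]. Extracting it from finitely many values
    with [|t| <= 1] bounds it by [5 ^ p] times the bound of [P_p], which is
    absorbed by dividing the radius, and differentiating the series of monomials
    of [P_p] by the Leibniz rule gives one for [DP_p].

    [TM] is metrized by embedding it in [M * X ^ J], by means of the fibre
    coordinates squashed into the unit ball and multiplied by the distance to the
    complement of the domain of the chart. *)

Require Import Defs.
From HB Require Import structures.
From mathcomp Require Import all_boot all_order all_algebra.
From mathcomp Require Import all_classical all_reals all_analysis.
From mathcomp Require Import ring lra finmap.

Set Implicit Arguments.
Unset Strict Implicit.
Unset Printing Implicit Defensive.

Import Order.TTheory GRing.Theory Num.Theory.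
Import numFieldNormedType.Exports.

Local Open Scope classical_set_scope.
Local Open Scope ring_scope.

(** * Norms *)

(** The chart [home x] is an arbitrary choice with no regularity in [x], so the product topology of
    [M * X] would in general make the fibre coordinates discontinuous. The topology has to be the
    one for which every [fib j] is continuous over its chart, and the countability of [J] lets one
    metric take care of all of them. The homogeneous terms are given only as limits of series of
    monomials, without a multilinear form to differentiate. This is why their derivatives are
    obtained from finitely many values: such an expression passes to pointwise limits. The power
    series at [zeta] is never expanded again at [zeta + z]. A holomorphic map has a derivative at
    [zeta + z] by its own power series there, and it remains to identify this derivative with the
    sum of the derived terms. The identification is tested on one real component of one coordinate
    along one line, where the mean value theorem applies; the summable bounds then restore
    convergence in norm. *)

Section QuatNorm.
Variable R : realType.
Implicit Types x y z : quat R.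

Lemma qnormM x y : `|x * y| = `|x| * `|y|.
Proof.
apply/eqP; rewrite -(@eqrXn2 _ 2)// ?mulr_ge0//.
by apply/eqP; rewrite exprMn !qnorm_sq !qnormsqE /=; ring.
Qed.

Lemma qnorm_qreal (r : R) : `|qreal r| = `|r|.
Proof.
apply/eqP; rewrite -(@eqrXn2 _ 2)//; apply/eqP.
by rewrite qnorm_sq qnormsqE real_normK ?num_real//=; ring.
Qed.

Lemma qscale_mull (r : R) x y : (r *: x) * y = r *: (x * y).
Proof. by case: x y => ????[????]; congr Quat => /=; ring. Qed.

Lemma qscale_mulr (r : R) x y : x * (r *: y) = r *: (x * y).
Proof. by case: x y => ????[????]; congr Quat => /=; ring. Qed.

Lemma qreal_mull (r : R) x : qreal r * x = r *: x.
Proof. by case: x => ????; congr Quat => /=; ring. Qed.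

Lemma qcomp_le x : [/\ `|qre x| <= `|x|, `|qi x| <= `|x|,
  `|qj x| <= `|x| & `|qk x| <= `|x|].
Proof.
by split; rewrite -ler_sqr ?nnegrE// qnorm_sq qnormsqE real_normK ?num_real//;
  have := sqr_ge0 (qre x); have := sqr_ge0 (qi x); have := sqr_ge0 (qj x);
  have := sqr_ge0 (qk x); lra.
Qed.

Lemma qnorm_le_comp x : `|x| <= `|qre x| + `|qi x| + `|qj x| + `|qk x|.
Proof.
rewrite -ler_sqr ?nnegrE ?addr_ge0// qnorm_sq qnormsqE.
rewrite -(real_normK (num_real (qre x))) -(real_normK (num_real (qi x))).
rewrite -(real_normK (num_real (qj x))) -(real_normK (num_real (qk x))).
have := normr_ge0 (qre x); have := normr_ge0 (qi x).
have := normr_ge0 (qj x); have := normr_ge0 (qk x).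
move: `|qre x| `|qi x| `|qj x| `|qk x| => a b c d a0 b0 c0 d0; nra.
Qed.

End QuatNorm.

Section Ell2Norm.
Variables (R : realType) (I : choiceType).
Implicit Types x y z : ell2 R I.

Lemma coordD x y i : (x + y) i = x i + y i. Proof. by []. Qed.
Lemma coordN x i : (- x) i = - x i. Proof. by []. Qed.
Lemma coordZ (a : R) x i : (a *: x) i = a *: x i. Proof. by []. Qed.
Lemma coord_sum (T : Type) (s : seq T) (P : pred T) (F : T -> ell2 R I) i :
  (\sum_(t <- s | P t) F t) i = \sum_(t <- s | P t) F t i.
Proof. by apply: (big_morph (fun x : ell2 R I => x i)). Qed.

Lemma ell2_normE x : `|x| = Num.sqrt (fine (ell2_sum x)). Proof. by []. Qed.

Lemma ell2_sumE x : ell2_sum x = (`|x| ^+ 2)%:E.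
Proof.
by rewrite ell2_normE sqr_sqrtr ?fineK ?ell2_fin// fine_ge0// ell2_sum_ge0.
Qed.

Lemma ell2_norm_le x (C : R) : 0 <= C ->
  (forall A : {fset I}, \sum_(i <- A) `|x i| ^+ 2 <= C ^+ 2) -> `|x| <= C.
Proof.
move=> C0 H; rewrite -ler_sqr ?nnegrE// -lee_fin -ell2_sumE.
apply: ge_ereal_sup => _ [A [fA _]] <-.
rewrite fsbig_finite//= sumEFin lee_fin; exact: H.
Qed.

Lemma ell2_norm_ge x (A : {fset I}) : \sum_(i <- A) `|x i| ^+ 2 <= `|x| ^+ 2.
Proof.
rewrite -lee_fin -ell2_sumE; apply: esum_ge; exists [set` A] => //.
by rewrite fsbig_finite//= set_fsetK sumEFin.
Qed.

Lemma norm_coord_le x i : `|x i| <= `|x|.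
Proof.
rewrite -ler_sqr ?nnegrE//; have := ell2_norm_ge x [fset i]%fset.
by rewrite big_seq_fset1.
Qed.

End Ell2Norm.

Lemma ell2_norm_dom (R : realType) (I J : choiceType) (x : ell2 R J)
    (y : ell2 R I) (C : R) : 0 <= C ->
  (ell2_sum x <= (C ^+ 2)%:E * ell2_sum y)%E -> `|x| <= C * `|y|.
Proof.
by move=> C0; rewrite !ell2_sumE -EFinM lee_fin -exprMn ler_sqr// ?nnegrE ?mulr_ge0.
Qed.

(** Lower semicontinuity of the norm: the sum over a finite set of coordinates passes to the limit,
    and the norm is the supremum over such sets. It later turns coordinatewise convergence into
    estimates in norm. *)
Lemma ell2_norm_lim (R : realType) (I : choiceType) (u : nat -> ell2 R I)
    (y : ell2 R I) (C : R) :
  (forall i, (fun n => u n i) @ \oo --> y i) ->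
  (\forall n \near \oo, `|u n| <= C) -> `|y| <= C.
Proof.
move=> uy uC.
have C0 : 0 <= C by case: uC => n _ /(_ n (leqnn n)); apply: le_trans.
apply: ell2_norm_le => // A.
have cA : (fun n => \sum_(i <- A) `|u n i| ^+ 2) @ \oo --> \sum_(i <- A) `|y i| ^+ 2.
  apply: cvg_big => // [|i _]; first by move=> x; exact: add_continuous.
  have cn : `|u x i| @[x --> \oo] --> `|y i| by apply: cvg_norm; exact: uy.
  exact: (cvgM cn cn).
apply: (cvgr_to_le cA); near=> n.
apply: le_trans (ell2_norm_ge _ _) _; rewrite ler_sqr ?nnegrE//.
by near: n; exact: uC.
Unshelve. all: by end_near. Qed.

(** * The product decomposition of the tangent model *)

Section Push.
Variables (R : realType) (I J : choiceType) (f : I -> J) (g : J -> option I).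
Hypotheses (fK : pcancel f g) (gK : ocancel g f).

(** Extension by [0] outside the range of [f]; the partial inverse [g] decides membership in that
    range. *)
Definition push_fun (x : ell2 R I) (j : J) : quat R := oapp (Defs.coord x) 0 (g j).

Lemma push_sum (x : ell2 R I) : (ell2_sum (push_fun x) <= ell2_sum x)%E.
Proof.
rewrite /ell2_sum (_ : \esum_(j in [set: J]) _ =
    \esum_(j in range f) (`|push_fun x j| ^+ 2)%:E)%E.
  rewrite (@reindex_esum _ _ _ [set: I] _ f)//.
    by apply: le_esum => i _; rewrite /push_fun fK.
  by split => // i j _ _ /(congr1 g); rewrite !fK => -[].
rewrite [in RHS]esum_mkcond; apply: eq_esum => j _.
case: ifPn => //; rewrite notin_setE => jf.
rewrite /push_fun; case: (g j) (gK j) => /= [i ij|_]; last by rewrite normr0 expr0n.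
by exfalso; apply: jf; exists i.
Qed.

Lemma push_summable (x : ell2 R I) : (ell2_sum (push_fun x) < +oo)%E.
Proof. exact: le_lt_trans (push_sum x) (coord_summable x). Qed.

Definition push x := Ell2 (push_summable x).

Lemma push_norm x : `|push x| <= `|x|.
Proof.
rewrite -[leRHS]mul1r; apply: ell2_norm_dom => //.
by rewrite expr1n mul1e; exact: push_sum.
Qed.

Lemma pushD x y : push (x + y) = push x + push y.
Proof. by apply: ell2P => j; rewrite /= /push_fun; case: (g j) => //=; rewrite addr0. Qed.
Lemma pushZ (a : R) x : push (a *: x) = a *: push x.
Proof. by apply: ell2P => j; rewrite /= /push_fun; case: (g j) => //=; rewrite scaler0. Qed.

End Push.

Section Split.
Variables (R : realType) (d : model).
Local Notation X := (qspace R d).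
Local Notation X2 := (qspace R (tangent_model d)).

Definition base_idx : coords (tangent_model d) -> option (coords d) :=
  match d return coords (tangent_model d) -> option (coords d) with
  | Hn n => fun j : 'I_(n + n) => match fintype.split j with inl i => Some i | _ => None end
  | l2H => fun j => if odd j then None else Some j./2
  end.
Definition vect_idx : coords (tangent_model d) -> option (coords d) :=
  match d return coords (tangent_model d) -> option (coords d) with
  | Hn n => fun j : 'I_(n + n) => match fintype.split j with inr i => Some i | _ => None end
  | l2H => fun j => if odd j then Some j./2 else None
  end.

Lemma base_idxK : pcancel (@base_coord d) base_idx.
Proof.
rewrite /base_idx; case: d => [n|] i /=.
  by have := @unsplitK n n (inl i) => /= ->.
by rewrite odd_double doubleK.
Qed.
Lemma vect_idxK : pcancel (@vect_coord d) vect_idx.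
Proof.
rewrite /vect_idx; case: d => [n|] i /=.
  by have := @unsplitK n n (inr i) => /= ->.
by rewrite odd_double/= uphalf_double.
Qed.
Lemma base_idxO : ocancel base_idx (@base_coord d).
Proof.
rewrite /base_idx; case: d => [n|] j /=.
  by have := @splitK n n j; case: (fintype.split j).
by have := odd_double_half j; case: (odd j).
Qed.
Lemma vect_idxO : ocancel vect_idx (@vect_coord d).
Proof.
rewrite /vect_idx; case: d => [n|] j /=.
  by have := @splitK n n j; case: (fintype.split j).
by have := odd_double_half j; case: (odd j).
Qed.
Lemma base_idx_vect i : base_idx (vect_coord i) = None.
Proof.
rewrite /base_idx; case: d i => [n|] i /=.
  by have := @unsplitK n n (inr i) => /= ->.
by rewrite odd_double.
Qed.
Lemma vect_idx_base i : vect_idx (base_coord i) = None.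
Proof.
rewrite /vect_idx; case: d i => [n|] i /=.
  by have := @unsplitK n n (inl i) => /= ->.
by rewrite odd_double.
Qed.

Lemma tangent_coordP (Q : coords (tangent_model d) -> Prop) :
  (forall i, Q (base_coord i)) -> (forall i, Q (vect_coord i)) -> forall j, Q j.
Proof.
move: Q; case: d => [n|] /= Q bQ vQ j; first by rewrite -[j]splitK; case: fintype.split.
rewrite -(odd_double_half j); case: odd => /=; [exact: vQ|exact: bQ].
Qed.

Definition join (a b : X) : X2 :=
  push base_idxK base_idxO a + push vect_idxK vect_idxO b.

Lemma join_base a b i : join a b (base_coord i) = a i.
Proof. by rewrite coordD/= /push_fun base_idxK vect_idx_base addr0. Qed.
Lemma join_vect a b i : join a b (vect_coord i) = b i.
Proof. by rewrite coordD/= /push_fun vect_idxK base_idx_vect add0r. Qed.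

Lemma base_join a b : base_part (join a b) = a.
Proof. by apply: ell2P => i; exact: join_base. Qed.
Lemma vect_join a b : vect_part (join a b) = b.
Proof. by apply: ell2P => i; exact: join_vect. Qed.
Lemma join_parts z : join (base_part z) (vect_part z) = z.
Proof.
by apply: ell2P => j; elim/tangent_coordP: j => i; rewrite ?join_base ?join_vect.
Qed.

Lemma joinD a b a' b' : join (a + a') (b + b') = join a b + join a' b'.
Proof. by rewrite /join !pushD addrACA. Qed.
Lemma joinZ (t : R) a b : join (t *: a) (t *: b) = t *: join a b.
Proof. by rewrite /join !pushZ scalerDr. Qed.
Lemma joinN a b : join (- a) (- b) = - join a b.
Proof. by rewrite -(scaleN1r a) -(scaleN1r b) joinZ scaleN1r. Qed.
Lemma join0 : join 0 0 = 0.
Proof. by have := joinZ 0 0 0; rewrite !scale0r. Qed.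
Lemma join_sum (s : seq nat) (F G : nat -> X) :
  join (\sum_(i <- s) F i) (\sum_(i <- s) G i) = \sum_(i <- s) join (F i) (G i).
Proof.
by elim: s => [|i s IH]; rewrite ?big_nil ?join0// !big_cons joinD IH.
Qed.
Lemma join_norm a b : `|join a b| <= `|a| + `|b|.
Proof. by rewrite (le_trans (ler_normD _ _))// lerD// push_norm. Qed.

Lemma reindex_sum (I J : choiceType) (f : I -> J) (fI : injective f) (z : ell2 R J) :
  (ell2_sum (Defs.coord z \o f) <= ell2_sum z)%E.
Proof.
apply: ge_ereal_sup => _ [A [fA _]] <-.
apply: esum_ge; exists (f @` A); first by split => //; exact: finite_image.
rewrite (@reindex_fsbig _ _ _ _ _ f A (f @` A))//=.
by split=> [i Ai | x y _ _ |//]; [exists i | exact: fI].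
Qed.

Lemma base_norm (z : X2) : `|base_part z| <= `|z|.
Proof.
rewrite -[leRHS]mul1r; apply: ell2_norm_dom => //.
by rewrite expr1n mul1e; apply: reindex_sum; exact: base_coord_inj.
Qed.
Lemma vect_norm (z : X2) : `|vect_part z| <= `|z|.
Proof.
rewrite -[leRHS]mul1r; apply: ell2_norm_dom => //.
by rewrite expr1n mul1e; apply: reindex_sum; exact: vect_coord_inj.
Qed.

Lemma baseD (y z : X2) : base_part (y + z) = base_part y + base_part z.
Proof. exact: ell2P. Qed.
Lemma vectD (y z : X2) : vect_part (y + z) = vect_part y + vect_part z.
Proof. exact: ell2P. Qed.
Lemma baseZ (a : R) (z : X2) : base_part (a *: z) = a *: base_part z.
Proof. exact: ell2P. Qed.
Lemma vectZ (a : R) (z : X2) : vect_part (a *: z) = a *: vect_part z.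
Proof. exact: ell2P. Qed.
Lemma baseB (y z : X2) : base_part (y - z) = base_part y - base_part z.
Proof. exact: ell2P. Qed.
Lemma vectB (y z : X2) : vect_part (y - z) = vect_part y - vect_part z.
Proof. exact: ell2P. Qed.

End Split.

(** * Coefficients of polynomials from their values *)

Section Interpolation.
Variable R : realType.
Implicit Types (s : seq (R * R)) (n k i : nat).

Definition moment s i : R := \sum_(c <- s) c.1 * c.2 ^+ i.

(* [s] lists weights and nodes, and extracts the coefficient of degree [k] from
   the values at the nodes of a polynomial of degree at most [n]. *)
Definition extracts n k s := forall i, (i <= n)%N -> moment s i = (i == k)%:R.

Lemma moment_scale s (a b : R) i :
  moment [seq (a * c.1, b * c.2) | c <- s] i = a * b ^+ i * moment s i.
Proof.
rewrite /moment big_map mulr_sumr; apply: eq_bigr => c _ /=.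
by rewrite exprMn; ring.
Qed.

Lemma moment_cat s s' i : moment (s ++ s') i = moment s i + moment s' i.
Proof. exact: big_cat. Qed.

(* [2 ^ m q(t / 2) - q(t)] has no term of degree [m]. *)
Definition dilate m k s : seq (R * R) :=
  let N := (2 ^+ (m - k) - 1)^-1 in
  [seq (2 ^+ m * N * c.1, 2^-1 * c.2) | c <- s] ++
  [seq (- N * c.1, 1 * c.2) | c <- s].

(** With [m = n + 1], the new moment of degree [i] is the old one times [N * (2 ^ (m - i) - 1)].
    This factor is [0] for [i = m] and [1] for [i = k]; in the other degrees the old moment is
    already [0]. *)
Lemma dilate_extracts n k s : (k <= n)%N ->
  extracts n k s -> extracts n.+1 k (dilate n.+1 k s).
Proof.
move=> kn Hs i im.
have N0 : 2 ^+ (n.+1 - k) - 1 != 0 :> R.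
  rewrite subr_eq0; apply/negP => /eqP H.
  suff : 1 < 2 ^+ (n.+1 - k) :> R by rewrite H ltxx.
  by rewrite exprn_egt1 ?subn_eq0 -?ltnNge// ltr1n.
rewrite moment_cat !moment_scale expr1n mulr1 -mulrDl.
have [->|ni] := eqVneq i n.+1.
  have -> : (n.+1 == k) = false by apply/negbTE; rewrite gtn_eqF ?ltnS.
  rewrite [X in X * _](_ : _ = 0) ?mul0r//.
  have : 2 ^+ n.+1 != 0 :> R by rewrite expf_neq0.
  by rewrite exprVn => ?; field; apply/andP.
rewrite Hs; last by rewrite -ltnS ltn_neqAle ni.
have [->|] := eqVneq i k; last by rewrite mulr0.
rewrite mulr1 -[X in 2 ^+ X * _ * _](subnK (leqW kn)) exprD exprVn.
have : 2 ^+ k != 0 :> R by rewrite expf_neq0.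
move: (2 ^+ k) (2 ^+ (n.+1 - k)) N0 => a b b0 a0.
by rewrite mulr1n; field; exact/andP.
Qed.

Definition in_unit s := all (fun c => `|c.2| <= 1) s.
Definition weight s : R := \sum_(c <- s) `|c.1|.

Lemma dilate_unit m k s : in_unit s -> in_unit (dilate m k s).
Proof.
move=> us; rewrite /in_unit all_cat !all_map; apply/andP; split.
  apply: sub_all us => c /= c1; rewrite normrM -[leRHS]mulr1 ler_pM//.
  by rewrite ger0_norm ?invr_ge0// invf_le1// ler1n.
by apply: sub_all us => c /= c1; rewrite mul1r.
Qed.

(** Origin of the constant [5]: with [P = 2 ^ n] the weight grows by the factor
    [(2 * P + 1) / (P - 1)], which decreases in [P] and equals [5] at [P = 2]. For [n = 0] the
    denominator vanishes. *)
Lemma dilate_weight n s : (0 < n)%N ->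
  weight (dilate n.+1 1 s) <= 5 * weight s.
Proof.
move=> n0; rewrite /weight big_cat/= !big_map -big_split/= mulr_sumr.
apply: ler_sum => c _ /=; rewrite !normrM -mulrDl ler_wpM2r//.
rewrite subn1/= normrN; set P := 2 ^+ n; rewrite exprS -/P.
have P2 : 2 <= P.
  rewrite /P; case: n n0 @P => // n _; rewrite exprS ler_peMr//.
  by rewrite exprn_ege1// ler1n.
rewrite !ger0_norm ?invr_ge0 ?mulr_ge0 ?subr_ge0//; try lra.
rewrite -[X in _ + X]mul1r -mulrDl ler_pdivrMr ?subr_gt0; lra.
Qed.

(** Induction on the degree: a lower coefficient is kept by cancelling the new top degree with
    [dilate], and the top coefficient is recovered separately. The weight is tracked for [k = 1]
    only, the coefficient that serves as a derivative. *)
Lemma extraction n k : (k <= n)%N -> exists s,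
  [/\ in_unit s, extracts n k s & k = 1%N -> weight s <= 5 ^+ n].
Proof.
elim: n k => [|n IH] k.
  rewrite leqn0 => /eqP ->; exists [:: (1, 1)]; split => //.
    by rewrite /in_unit /= normr1 lexx.
  by move=> i; rewrite leqn0 => /eqP ->; rewrite /moment big_seq1 expr0 mulr1.
have low j : (j <= n)%N -> exists s,
    [/\ in_unit s, extracts n.+1 j s & j = 1%N -> weight s <= 5 ^+ n.+1].
  move=> jn; have [s [us es ws]] := IH j jn.
  exists (dilate n.+1 j s); split; first exact: dilate_unit.
    exact: dilate_extracts.
  move=> j1; rewrite j1 in jn ws *; rewrite exprS.
  by apply: le_trans (dilate_weight _ jn) _; rewrite ler_pM2l// ws.
rewrite leq_eqVlt ltnS => /orP[/eqP ->|]; last exact: low.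
case: n {IH} low => [|n] low.
  (* For degree at most [1] the top coefficient is the one whose weight matters; the central
     difference has weight [1]. *)
  exists [:: (2^-1, 1); (- 2^-1, -1)]; split.
  - by rewrite /in_unit /= normrN normr1 lexx.
  - move=> i; rewrite leq_eqVlt ltnS leqn0 => /orP[] /eqP ->;
      rewrite /moment big_cons big_seq1/= ?expr1 ?expr0; by field.
  - move=> _; rewrite /weight big_cons big_seq1/= normrN ger0_norm; lra.
have /choice[f Hf] : forall j, exists s,
    (j <= n.+1)%N -> in_unit s /\ extracts n.+2 j s.
  move=> j; have [jn|] := leqP j n.+1; last by exists [::].
  by have [s [? ? _]] := low j jn; exists s.
(* The value at [1] is the sum of all coefficients, so the top one is this value minus the lower
   ones. *)
exists ((1, 1) :: flatten [seq [seq (- c.1, c.2) | c <- f j] | j <- iota 0 n.+2]).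
split => //.
  apply/allP => c; rewrite inE => /orP[/eqP -> /=|]; first by rewrite normr1.
  move=> /allpairsPdep[j [c' [+ cf ->]]]; rewrite mem_iota add0n ltnS => /= jn.
  by have [/allP + _] := Hf j jn; apply.
move=> i im; rewrite /moment big_cons big_flatten big_map expr1n mulr1.
rewrite (eq_big_seq (fun j => - (i == j)%:R)); last first.
  move=> j; rewrite mem_iota add0n ltnS => /= jn.
  have [_ /(_ i im) <-] := Hf j jn.
  by rewrite big_map /moment -sumrN; apply: eq_bigr => c _; rewrite mulNr.
rewrite sumrN.
have [->|ni] := eqVneq i n.+2.
  rewrite big_seq big1 ?subr0// => j; rewrite mem_iota add0n => /= jn.
  by rewrite gtn_eqF.
rewrite (bigD1_seq i) ?iota_uniq//; last first.
  by rewrite mem_iota add0n ltn_neqAle ni.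
rewrite eqxx big1 => [|j /negbTE]; first by rewrite [X in _ - X]addr0 subrr.
by rewrite eq_sym => ->.
Qed.

End Interpolation.

Section Coefficients.
Variable R : realType.
Implicit Types (n k p : nat) (s : seq (R * R)).

Definition extract (V : lmodType R) s (g : R -> V) : V := \sum_(c <- s) c.1 *: g c.2.

Lemma extract_norm (V : normedModType R) s (g : R -> V) (B : R) :
  in_unit s -> (forall t, `|t| <= 1 -> `|g t| <= B) ->
  `|extract s g| <= weight s * B.
Proof.
move=> us gB; rewrite (le_trans (ler_norm_sum _ _ _))// /weight mulr_suml.
rewrite big_seq [leRHS]big_seq; apply: ler_sum => c cs.
by rewrite normrZ ler_wpM2l// gB// (allP us).
Qed.

Lemma extract_cvg (V : normedModType R) s (g : nat -> R -> V) (f : R -> V) :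
  (forall t, (fun n => g n t) @ \oo --> f t) ->
  (fun n => extract s (g n)) @ \oo --> extract s f.
Proof.
move=> gf; apply: cvg_big => [|c _]; first by move=> x; exact: add_continuous.
by apply: cvgZr; exact: gf.
Qed.

Definition has_coefs (V : lmodType R) p (g : R -> V) (a : nat -> V) :=
  (forall i, (p < i)%N -> a i = 0) /\
  forall t, g t = \sum_(i < p.+1) t ^+ i *: a i.

Lemma extract_coef (V : lmodType R) p k s (g : R -> V) a :
  extracts p k s -> has_coefs p g a -> extract s g = a k.
Proof.
move=> es [a0 ga]; rewrite /extract.
under eq_bigr do rewrite ga scaler_sumr.
rewrite exchange_big/=.
have E (i : 'I_p.+1) : \sum_(c <- s) c.1 *: (c.2 ^+ i *: a i) = (i == k :> nat)%:R *: a i.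
  rewrite -es; last by rewrite -ltnS.
  by rewrite /moment scaler_suml; apply: eq_bigr => c _; rewrite scalerA.
rewrite (eq_bigr _ (fun i _ => E i)).
have [kp|pk] := leqP k p.
  rewrite (bigD1 (Ordinal (kp : k < p.+1)%N))//= eqxx scale1r big1 ?addr0// => i.
  by rewrite -val_eqE/= => /negbTE ->; rewrite scale0r.
rewrite a0// big1// => i _; rewrite (ltn_eqF _) ?scale0r//.
by rewrite (leq_ltn_trans _ pk)// -ltnS.
Qed.

(** Polynomials of bounded degree are closed under pointwise limits, because each coefficient is a
    fixed finite combination of values and therefore converges. *)
Lemma has_coefs_lim (V : normedModType R) p (g : nat -> R -> V) (f : R -> V) a :
  (forall n, has_coefs p (g n) (a n)) ->
  (forall t, (fun n => g n t) @ \oo --> f t) ->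
  exists b, has_coefs p f b.
Proof.
move=> ga gf.
have /choice[s Hs] : forall k, exists s, (k <= p)%N -> extracts p k s.
  move=> k; have [kp|] := leqP k p; last by exists [::].
  by have [s [_ ? _]] := extraction R kp; exists s.
exists (fun k => if (k <= p)%N then extract (s k) f else 0); split.
  by move=> i; rewrite ltnNge => /negbTE ->.
move=> t; apply: (cvg_unique _ (gf t)); first exact: norm_hausdorff.
rewrite /= (_ : (fun n => g n t) = fun n => \sum_(i < p.+1) t ^+ i *: a n i); last first.
  by apply/funext => n; rewrite (proj2 (ga n)).
apply: cvg_big => [|i _]; first by move=> x; exact: add_continuous.
have ip : (i <= p)%N by rewrite -ltnS.
rewrite ip; apply: cvgZr.
rewrite (_ : (fun n => a n i) = fun n => extract (s i) (g n)); first exact: extract_cvg.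
by apply/funext => n; rewrite (extract_coef (Hs i ip) (ga n)).
Qed.

Lemma nodes_exist p : exists s : seq (R * R),
  [/\ in_unit s, extracts p 1 s & weight s <= 5 ^+ p].
Proof.
case: p => [|p]; last by have [s [? ? ?]] := @extraction R p.+1 1 isT; exists s; split=> //; auto.
(* In degree [0] the coefficient of [t] is [0], given by the empty combination. *)
exists [::]; split => //; last by rewrite /weight big_nil.
by move=> i; rewrite leqn0 => /eqP ->; rewrite /moment big_nil.
Qed.

Definition nodes p := projT1 (cid (nodes_exist p)).
Lemma nodesP p :
  [/\ in_unit (nodes p), extracts p 1 (nodes p) & weight (nodes p) <= 5 ^+ p].
Proof. exact: (projT2 (cid (nodes_exist p))). Qed.

Lemma has_coefsD (V : lmodType R) p (f g : R -> V) a b :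
  has_coefs p f a -> has_coefs p g b ->
  has_coefs p (fun t => f t + g t) (fun i => a i + b i).
Proof.
move=> [a0 fa] [b0 gb]; split=> [i pi|t]; first by rewrite a0// b0// addr0.
by rewrite fa gb -big_split; apply: eq_bigr => i _; rewrite /= scalerDr.
Qed.

(** The variable [t] is real, hence central: its powers move out of a product while the quaternion
    factors keep their order. *)
Lemma has_coefs_mul p (g : R -> quat R) a (x y : quat R) :
  has_coefs p g a -> has_coefs p.+1 (fun t => (x + t *: y) * g t)
    (fun i => x * a i + (if i is j.+1 then y * a j else 0)).
Proof.
move=> [a0 ga]; split=> [i|t].
  case: i => // i pi; rewrite !a0//; last exact: ltnW.
  by rewrite !mulr0 addr0.
rewrite (eq_bigr (fun i : 'I_p.+2 => t ^+ i *: (x * a i) +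
  t ^+ i *: (if nat_of_ord i is j.+1 then y * a j else 0))); last first.
  by move=> i _; rewrite scalerDr.
rewrite big_split/= big_ord_recr/= a0// mulr0 scaler0 addr0.
rewrite [X in _ = _ + X]big_ord_recl/= scaler0 add0r mulrDl ga; congr +%R.
  by rewrite mulr_sumr; apply: eq_bigr => i _; rewrite qscale_mulr.
rewrite mulr_sumr; apply: eq_bigr => i _.
by rewrite qscale_mulr qscale_mull scalerA /bump/= exprS mulrC.
Qed.

Lemma has_coefs_mull p (g : R -> quat R) a (x : quat R) :
  has_coefs p g a -> has_coefs p (fun t => x * g t) (fun i => x * a i).
Proof.
move=> [a0 ga]; split=> [i pi|t]; first by rewrite a0// mulr0.
by rewrite ga mulr_sumr; apply: eq_bigr => i _; rewrite qscale_mulr.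
Qed.

End Coefficients.

(** * Homogeneous terms and their derivatives *)

Lemma raw_linear0 (R : realType) (V W : lmodType R) (L : V -> W) :
  (forall (a : R) u v, L (a *: u + v) = a *: L u + L v) -> L 0 = 0.
Proof.
move=> Llin; have := Llin 1 0 0; rewrite scaler0 addr0 scale1r => /esym/eqP.
by rewrite addrC -subr_eq0 addrK => /eqP.
Qed.

Lemma raw_linearZ (R : realType) (V W : lmodType R) (L : V -> W) :
  (forall (a : R) u v, L (a *: u + v) = a *: L u + L v) ->
  forall a u, L (a *: u) = a *: L u.
Proof.
by move=> Llin a u; rewrite -[a *: u]addr0 Llin (raw_linear0 Llin) addr0.
Qed.

Section Homogeneous.
Variables (R : realType) (I J : choiceType).
Implicit Types (l : seq (I * quat R)) (z h : ell2 R I) (p : nat).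

Definition mprod l z : quat R := \prod_(s <- l) (z s.1 * s.2).

Fixpoint dprod l z h : quat R :=
  if l is s :: l' then
    z s.1 * (s.2 * dprod l' z h) + h s.1 * (s.2 * mprod l' z)
  else 0.

Lemma mprod_coefs l z h : exists a,
  [/\ has_coefs (size l) (fun t => mprod l (z + t *: h)) a,
      a 0%N = mprod l z & a 1%N = dprod l z h].
Proof.
elim: l => [|[s b] l [a [Ha a0 a1]]].
  exists (fun i => if i is 0%N then 1 else 0); split; rewrite /mprod ?big_nil//.
  split=> [[]//|t]; rewrite big_nil big_ord_recr big_ord0/=.
  by rewrite expr0 scale1r add0r.
have := has_coefs_mul (z s) (h s) (has_coefs_mull b Ha).
set a' := (X in has_coefs _ _ X) => Ha'; exists a'; split.
- case: Ha' => p0 E; split => // t; rewrite -E.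
  by rewrite /mprod big_cons/= mulrA.
- by rewrite /a' addr0 a0 /mprod big_cons mulrA.
- by rewrite /a' a1 a0.
Qed.

Lemma qmonomialE (m : quat R * seq (I * quat R)) z :
  qmonomial m z = m.1 * mprod m.2 z.
Proof. by []. Qed.

Definition dmono (m : quat R * seq (I * quat R)) z h := m.1 * dprod m.2 z h.

Lemma series_coefs p (m : nat -> quat R * seq (I * quat R)) z h :
  (forall n, size (m n).2 = p) -> forall n, exists a,
  has_coefs p (fun t => series (fun n => qmonomial (m n) (z + t *: h)) n) a /\
  a 1%N = series (fun n => dmono (m n) z h) n.
Proof.
move=> sm; elim=> [|n [a [Ha a1]]].
  exists (fun=> 0); split; last by rewrite /series/= big_geq.
  by split=> // t; rewrite /series/= big_geq// big1// => i _; rewrite scaler0.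
have [b [Hb b0 b1]] := mprod_coefs (m n).2 z h.
exists (fun i => a i + (m n).1 * b i); split; last first.
  by rewrite a1 b1 /series/= big_nat_recr.
rewrite -(sm n) in Ha *.
have := has_coefsD Ha (has_coefs_mull (m n).1 Hb).
rewrite (_ : (fun t => _ + _) = fun t =>
  series (fun n => qmonomial (m n) (z + t *: h)) n.+1)//.
by apply/funext => t; rewrite /series/= big_nat_recr.
Qed.

(** Along a line every partial sum of monomials is a polynomial in [t] of degree at most [p], and
    [has_coefs_lim] applies. *)
Lemma homog_coefs p (P : ell2 R I -> ell2 R J) z h k : qhomogeneous p P ->
  exists b, has_coefs p (fun t => P (z + t *: h) k) b.
Proof.
move=> /(_ k)[m [sm cm]]; have /choice[a Ha] := series_coefs z h sm.
apply: (@has_coefs_lim _ _ _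
  (fun n t => series (fun n => qmonomial (m n) (z + t *: h)) n) _ a) => [n|t].
  by have [] := Ha n.
exact: cm.
Qed.

(* The coefficient of [t] in [P (z + t *: h)], for [P] homogeneous of degree [p]. *)
Definition dhom p (P : ell2 R I -> ell2 R J) z h : ell2 R J :=
  extract (nodes R p) (fun t => P (z + t *: h)).

Lemma dhom_coord p (P : ell2 R I -> ell2 R J) z h k :
  dhom p P z h k = extract (nodes R p) (fun t => P (z + t *: h) k).
Proof. by rewrite /dhom /extract coord_sum. Qed.

(** The extraction is a finite sum of values, so it commutes with the limit of the series. *)
Lemma dhom_series p (P : ell2 R I -> ell2 R J) z h k m :
  (forall n, size (m n).2 = p) ->
  (forall z, series (fun n => qmonomial (m n) z) @ \oo --> P z k) ->
  series (fun n => dmono (m n) z h) @ \oo --> dhom p P z h k.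
Proof.
move=> sm cm; have [_ en _] := nodesP R p.
rewrite dhom_coord (_ : series _ = fun n => extract (nodes R p)
  (fun t => series (fun n => qmonomial (m n) (z + t *: h)) n)).
  by apply: extract_cvg => t; exact: cm.
apply/funext => n; have [a [Ha <-]] := series_coefs z h sm n.
by rewrite (extract_coef en Ha).
Qed.

Lemma dhom_scale p (P : ell2 R I -> ell2 R J) z h (c : R) : qhomogeneous p P ->
  dhom p P z (c *: h) = c *: dhom p P z h.
Proof.
move=> hP; have [_ en _] := nodesP R p.
apply: ell2P => k; rewrite coordZ !dhom_coord.
have [b Hb] := homog_coefs z h k hP; rewrite (extract_coef en Hb).
have Hc : has_coefs p (fun t => P (z + t *: (c *: h)) k) (fun i => c ^+ i *: b i).
  case: Hb => b0 Hb; split => [i pi|t]; first by rewrite b0// scaler0.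
  rewrite scalerA Hb; apply: eq_bigr => i _; by rewrite scalerA exprMn.
by rewrite (extract_coef en Hc).
Qed.

Lemma mprod_scale l z (t : R) : mprod l (t *: z) = t ^+ size l *: mprod l z.
Proof.
elim: l => [|s l IH]; rewrite /mprod ?big_nil ?expr0 ?scale1r// !big_cons.
rewrite -/(mprod l _) -/(mprod l z) IH coordZ/= qscale_mull qscale_mull.
by rewrite qscale_mulr scalerA exprS.
Qed.

Lemma homog_scale p (P : ell2 R I -> ell2 R J) z (t : R) : qhomogeneous p P ->
  P (t *: z) = t ^+ p *: P z.
Proof.
move=> hP; apply: ell2P => k; have [m [sm cm]] := hP k.
apply: (cvg_unique _ (cm (t *: z))); first exact: norm_hausdorff.
rewrite coordZ /= (_ : series _ = fun n => t ^+ p *: series (fun n => qmonomial (m n) z) n).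
  by apply: cvgZr; exact: cm.
apply/funext => n; rewrite /series/= scaler_sumr; apply: eq_bigr => i _.
by rewrite !qmonomialE mprod_scale sm qscale_mulr.
Qed.

Lemma homog0 p (P : ell2 R I -> ell2 R J) : qhomogeneous p P -> (0 < p)%N -> P 0 = 0.
Proof.
move=> hP p0; have := homog_scale 0 0 hP.
by rewrite scaler0 expr0n (gtn_eqF p0) scale0r.
Qed.

Lemma homog_const (P : ell2 R I -> ell2 R J) z : qhomogeneous 0 P -> P z = P 0.
Proof. by move=> hP; rewrite -(scale0r z) (homog_scale _ _ hP) expr0 scale1r. Qed.

Lemma homog1_linear (P : ell2 R I -> ell2 R J) (t : R) y z : qhomogeneous 1 P ->
  P (t *: y + z) = t *: P y + P z.
Proof.
move=> hP; apply: ell2P => k; have [m [sm cm]] := hP k.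
apply: (cvg_unique _ (cm _)); first exact: norm_hausdorff.
rewrite coordD coordZ /= (_ : series _ = fun n =>
  t *: series (fun n => qmonomial (m n) y) n + series (fun n => qmonomial (m n) z) n).
  by apply: cvgD; [apply: cvgZr; exact: cm|exact: cm].
apply/funext => n; rewrite /series/= scaler_sumr -big_split; apply: eq_bigr => i _.
rewrite /= !qmonomialE; have := sm i; case: (m i).2 => [//|s [|//]] _.
rewrite /mprod !big_seq1 coordD coordZ /= mulrDl mulrDr qscale_mull.
by rewrite qscale_mulr.
Qed.

(* The ball of radius [r / 10] leaves room for the nodes ([|t| <= 1]), and the
   factor [5] absorbs the weights by homogeneity. *)
Lemma dhom_norm p (P : ell2 R I -> ell2 R J) (r b : R) z h : 0 < r ->
  qhomogeneous p P -> (forall z, `|z| < r -> `|P z| <= b) ->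
  `|z| < r / 10 -> `|h| < r / 10 -> `|dhom p P z h| <= b.
Proof.
move=> r0 hP Pb zr hr; have [un _ wn] := nodesP R p.
have b0 : 0 <= b by apply: le_trans (Pb 0 _); rewrite ?normr0.
have H t : `|t| <= 1 -> `|P (z + t *: h)| <= 5 ^- p * b.
  move=> t1; pose y := (5 : R) *: (z + t *: h).
  have -> : z + t *: h = 5^-1 *: y.
    by rewrite scalerA mulVf ?scale1r.
  have n5 : `|(5^-1 : R) ^+ p| = 5 ^- p by rewrite ger0_norm ?exprVn// invr_ge0 exprn_ge0.
  rewrite (homog_scale _ _ hP) normrZ n5 ler_wpM2l ?invr_ge0 ?exprn_ge0// Pb//.
  rewrite normrZ ger0_norm//.
  have : `|z + t *: h| <= `|z| + `|h|.
    by rewrite (le_trans (ler_normD _ _))// lerD2l normrZ ler_piMl.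
  lra.
rewrite (le_trans (extract_norm un H))//.
rewrite mulrA ler_piMl// ler_pdivrMr ?mul1r// exprn_gt0//.
Qed.

Section Component.
Variable chi : quat R -> R.
Hypothesis chiL : forall (a : R) x y, chi (a *: x + y) = a * chi x + chi y.

Lemma functional_sum (n : nat) (F : nat -> R) (a : nat -> quat R) :
  chi (\sum_(i < n) F i *: a i) = \sum_(i < n) F i * chi (a i).
Proof.
have chi0 : chi 0 = 0 by exact: (@raw_linear0 _ _ R^o chi chiL).
elim: n => [|n IH]; first by rewrite !big_ord0.
by rewrite !big_ord_recr/= addrC chiL IH addrC.
Qed.

(** Passing to a real component [chi] produces real polynomials, to which the mean value theorem can
    be applied. *)
Lemma homog_poly p (P : ell2 R I -> ell2 R J) z h k : qhomogeneous p P ->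
  exists G : {poly R}, forall t,
    chi (P (z + t *: h) k) = G.[t] /\ chi (dhom p P (z + t *: h) h k) = G^`().[t].
Proof.
move=> hP; have [_ en _] := nodesP R p.
have [b Hb] := homog_coefs z h k hP.
pose G := \poly_(i < p.+1) chi (b i).
have GE t : chi (P (z + t *: h) k) = G.[t].
  rewrite (proj2 Hb) functional_sum horner_poly.
  by apply: eq_bigr => i _; rewrite mulrC.
exists G => t; split; first exact: GE.
have [c Hc] := homog_coefs (z + t *: h) h k hP.
rewrite dhom_coord (extract_coef en Hc).
(* The same function of [u] is expanded twice: from [P] along the line through [z + t *: h], and by
   the Taylor formula for [G] at [t]. Extracting the coefficient of [u] from both expansions gives
   the second identity. *)
pose g (u : R) : R^o := G.[t + u].
have g1 : has_coefs p g (fun i => (chi (c i) : R^o)).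
  split=> [i pi|u]; first by rewrite (proj1 Hc)// (@raw_linear0 _ _ R^o chi chiL).
  rewrite /g -GE scalerDl addrA (proj2 Hc) functional_sum.
  exact: eq_bigr.
have sG : (size G <= p.+1)%N by exact: size_poly.
have g2 : has_coefs p g (fun i => (G^`N(i).[t] : R^o)).
  split=> [i pi|u].
    by rewrite nderivn_poly0 ?horner0// (leq_trans sG).
  rewrite /g (nderiv_taylor_wide _ sG); last exact: mulrC.
  by apply: eq_bigr => i _; rewrite mulrC.
by rewrite -[LHS](extract_coef en g1) (extract_coef en g2) nderivn1.
Qed.

End Component.

End Homogeneous.

(** * Derivatives of power series *)

Section FrechetDerivative.
Variables (R : realType) (V W : normedModType R).

(** The derivative is a plain function here, so that candidates such as [P 1] can be proposed before
    they are known to be linear and continuous. *)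
Definition is_fder (f : V -> W) (x : V) (L : V -> W) :=
  [/\ forall (a : R) u v, L (a *: u + v) = a *: L u + L v,
      exists C : R, forall v, `|L v| <= C * `|v| &
      forall e : R, 0 < e -> \forall h \near (0 : V),
        `|f (x + h) - f x - L h| <= e * `|h|].

Lemma is_fder_diff f x L : is_fder f x L ->
  differentiable f x /\ 'd f x = L :> (V -> W).
Proof.
move=> [Llin [C LC] Le].
pose Lmix := GRing.isLinear.Build R V W _ L Llin.
pose Lf : {linear V -> W} := HB.pack L Lmix.
have Lcont : continuous Lf.
  apply: bounded_linear_continuous; apply/linear_boundedP.
  near=> r => v; rewrite (le_trans (LC v))// ler_wpM2r//.
have Lo : f \o shift x = cst (f x) + Lf +o_ 0 id.
  apply/eqaddoP => e e0; have := Le e e0; apply: filterS => h.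
  suff -> : (f \o shift x - (cst (f x) + Lf)) h = f (x + h) - f x - L h by [].
  by rewrite -[LHS]/(f (h + x) - (f x + L h)) opprD addrA [h + x]addrC.
have dL : 'd f x = Lf :> (V -> W) by exact: diff_unique.
by split=> //; apply/diff_locallyP; rewrite dL.
Unshelve. all: by end_near. Qed.

Lemma diff_is_fder f x : differentiable f x -> is_fder f x ('d f x).
Proof.
move=> dfx; have [dc do_] := iffLR (diff_locallyP _ _) dfx; split.
- by move=> a u v; rewrite linearP.
- have /linear_bounded_continuous/linear_boundedP := dc.
  by move=> [C [_ CP]]; exists (C + 1); apply: CP; rewrite ltrDl.
- move=> e e0; move/eqaddoP: do_ => /(_ e e0); apply: filterS => h.
  suff -> : (f \o shift x - (cst (f x) + 'd f x)) h = f (x + h) - f x - 'd f x h by [].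
  by rewrite -[LHS]/(f (h + x) - (f x + 'd f x h)) opprD addrA [h + x]addrC.
Qed.

Lemma near_is_fder f g x L : (\forall y \near x, f y = g y) ->
  is_fder f x L -> is_fder g x L.
Proof.
move=> fg [l b H]; split => // e e0.
have fgx : \forall h \near (0 : V), f (x + h) = g (x + h).
  move: fg; rewrite (near_shift 0 x); apply: filterS => k /=.
  by rewrite subr0 addrC.
near=> h.
have -> : g x = f x by rewrite (nbhs_singleton fg).
have <- : f (x + h) = g (x + h) by near: h.
by near: h; exact: H.
Unshelve. all: by end_near. Qed.

End FrechetDerivative.

Lemma is_fder_comp (R : realType) (U V W : normedModType R) (f : U -> V)
  (g : V -> W) x L K : is_fder f x L -> is_fder g (f x) K ->
  is_fder (g \o f) x (K \o L).
Proof.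
move=> Hf Hg; have [df fL] := is_fder_diff Hf; have [dg gK] := is_fder_diff Hg.
have dgf : differentiable (g \o f) x by exact: differentiable_comp.
have := diff_is_fder dgf.
by rewrite diff_comp// fL gK.
Qed.

Lemma lim_norm_le (R : realType) (V : normedModType R) (u : nat -> V) y C N :
  u @ \oo --> y -> (forall n, (N <= n)%N -> `|u n| <= C) -> `|y| <= C.
Proof.
move=> uy uC; have un : (fun n => `|u n|) @ \oo --> `|y| by exact: cvg_norm.
apply: (cvgr_to_le un).
by exists N => // n /= Nn; exact: uC.
Qed.

Section SeriesBounds.
Variables (R : realType) (b : nat -> R).
Hypotheses (b0 : forall n, 0 <= b n) (cb : cvgn (series b)).

Lemma series_le_lim N : series b N <= limn (series b).
Proof. by apply: nondecreasing_cvgn_le => //; apply: nondecreasing_series. Qed.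

Lemma sum_le_tail N M : \sum_(N <= p < M) b p <= limn (series b) - series b N.
Proof.
have [MN|NM] := leqP M N; first by rewrite big_geq// subr_ge0 series_le_lim.
by rewrite -(sub_series_geq _ (ltnW NM)) lerD2r series_le_lim.
Qed.

Lemma tail_cvg0 : (fun N => limn (series b) - series b N) @ \oo --> 0.
Proof. by rewrite -(subrr (limn (series b))); apply: cvgB => //; exact: cvg_cst. Qed.

Lemma series_near (V : normedModType R) (u : nat -> V) y N :
  series u @ \oo --> y -> (forall p, (N <= p)%N -> `|u p| <= b p) ->
  `|y - series u N| <= limn (series b) - series b N.
Proof.
move=> uy ub; apply: (@lim_norm_le _ _ (fun n => series u n - series u N) _ _ N).
  by apply: cvgB => //; exact: cvg_cst.
move=> n Nn; rewrite sub_series_geq// (le_trans (ler_norm_sum _ _ _))//.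
rewrite (le_trans _ (sum_le_tail N n))// big_nat_cond [leRHS]big_nat_cond.
by apply: ler_sum => p; rewrite andbT => /andP[Np _]; exact: ub.
Qed.

End SeriesBounds.

(** [F] is already assumed differentiable at [0]; the value [l] has to be identified. By the mean
    value theorem applied to each later term, the increments of [F] and of the [N]-th partial sum
    over [[0, t]] differ by at most [t] times the tail of [b]. The partial sum is a polynomial, so
    its difference quotient is close to its derivative at [0] for small [t]. *)
Lemma termwise_derivative (R : realType) (G : nat -> {poly R}) (b : nat -> R)
    (F : R -> R) (l : R) :
  cvgn (series b) ->
  (forall p t, `|t| <= 1 -> `|(G p)^`().[t]| <= b p) ->
  (forall t, `|t| <= 1 -> series (fun p => (G p).[t]) @ \oo --> F t) ->
  (forall e, 0 < e -> \forall t \near (0 : R), `|F t - F 0 - t * l| <= e * `|t|) ->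
  forall N, `|l - series (fun p => (G p)^`().[0]) N| <= limn (series b) - series b N.
Proof.
move=> cb Gb GF Fl N.
have b0 p : 0 <= b p by apply: le_trans (Gb p 0 _); rewrite ?normr0.
set tau := limn _ - _.
have mvt (H : {poly R}) t : 0 < t -> exists2 c, 0 < c < t & H.[t] - H.[0] = t * H^`().[c].
  move=> t0; have [|c] := @MVT R (horner H) (horner H^`()) 0 t t0 (fun x _ => is_derive_poly H x).
    by apply: continuous_subspaceT; exact: continuous_horner.
  by rewrite in_itv/= subr0 mulrC => ? E; exists c.
apply/ler_addgt0Pr => e e0; pose d := e / 2; have d0 : 0 < d by rewrite divr_gt0.
pose H := \sum_(0 <= p < N) G p.
have HE t : H.[t] = series (fun p => (G p).[t]) N by rewrite /H horner_sum.
have HdE t : H^`().[t] = series (fun p => (G p)^`().[t]) N.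
  by rewrite /H raddf_sum horner_sum.
have cH : (horner H^`()) @ (0 : R) --> H^`().[0] by exact: continuous_horner.
have /nbhs_ballP[r /= r0 Hr] : \forall t \near (0 : R),
    `|H^`().[0] - H^`().[t]| <= d /\ `|F t - F 0 - t * l| <= d * `|t|.
  by apply: filterI; [move/cvgrPdist_le: cH; apply | exact: Fl].
pose t := Num.min (r / 2) 1.
have t0 : 0 < t by rewrite lt_min ltr01 divr_gt0.
have t1 : `|t| <= 1 by rewrite gtr0_norm// ge_min lexx orbT.
have tr : t < r by rewrite gt_min; apply/orP; left; lra.
have [c /andP[c0 ct] Hc] := mvt H t t0.
have [_ Ft] : `|H^`().[0] - H^`().[t]| <= d /\ `|F t - F 0 - t * l| <= d * `|t|.
  by apply: Hr; rewrite /ball/= sub0r normrN gtr0_norm.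
have [Hc0 _] : `|H^`().[0] - H^`().[c]| <= d /\ `|F c - F 0 - c * l| <= d * `|c|.
  by apply: Hr; rewrite /ball/= sub0r normrN gtr0_norm// (lt_trans ct).
have tail : `|F t - F 0 - (H.[t] - H.[0])| <= t * tau.
  have cs : series (fun p => (G p).[t] - (G p).[0]) @ \oo --> F t - F 0.
    have -> : series (fun p => (G p).[t] - (G p).[0]) =
        (fun n => series (fun p => (G p).[t]) n - series (fun p => (G p).[0]) n).
      by apply/funext => n; rewrite /series/= sumrB.
    by apply: cvgB; apply: GF; rewrite ?normr0.
  have tb : series (fun p => t * b p) @ \oo --> t * limn (series b).
    rewrite (_ : series _ = (fun n => t * series b n)).
      by apply: cvgM => //; exact: cvg_cst.
    by apply/funext => n; rewrite /series/= mulr_sumr.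
  have cb' := cvgP _ tb.
  have lb' : limn (series (fun p => t * b p)) = t * limn (series b) by exact: cvg_lim.
  have := @series_near _ (fun p => t * b p) _ cb' _ _ _ N cs.
  have -> : series (fun p => (G p).[t] - (G p).[0]) N = H.[t] - H.[0].
    by rewrite !HE /series/= sumrB.
  have -> : t * tau = limn (series (fun p => t * b p)) - series (fun p => t * b p) N.
    by rewrite lb' /tau mulrBr; congr (_ - _); rewrite /series/= mulr_sumr.
  apply => p; first by rewrite mulr_ge0// ltW.
  move=> _; have [q /andP[q0 qt] ->] := mvt (G p) t t0.
  rewrite normrM gtr0_norm// ler_wpM2l ?(ltW t0)// Gb// gtr0_norm//.
  by rewrite (le_trans (ltW qt))// -(gtr0_norm t0).
rewrite -HdE -(ler_pM2l t0) -[X in X * `|_|](gtr0_norm t0) -normrM.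
have -> : t * (l - H^`().[0]) = (F t - F 0 - (H.[t] - H.[0])) -
    (F t - F 0 - t * l) - t * (H^`().[0] - H^`().[c]).
  by rewrite Hc; ring.
rewrite (le_trans (ler_normB _ _))// (le_trans (lerD (ler_normB _ _) (lexx _)))//.
rewrite (gtr0_norm t0) in Ft; rewrite [X in _ + X]normrM (gtr0_norm t0).
rewrite (_ : t * (tau + e) = t * tau + d * t + t * d); last by rewrite /d; field.
by rewrite !lerD// ler_wpM2l// ltW.
Qed.

(** * Regrouping of series and domination of monomials *)

Section Flatten.
Variables (R : realType) (V : normedModType R) (T : eqType) (t0 : T) (K : nat).
Hypothesis K0 : (0 < K)%N.

Definition regroup (M : nat -> seq T) (n : nat) : T := nth t0 (M (n %/ K)%N) (n %% K)%N.

(** A partial sum of the flattened series consists of complete groups and of fewer than [K] terms of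
    the next group, which are together at most [K * eps]. *)
Lemma regroup_series (M : nat -> seq T) (g : T -> V) (eps : nat -> R) (y : V) :
  (forall n, size (M n) = K) ->
  series (fun n => \sum_(m <- M n) g m) @ \oo --> y ->
  (forall n m, m \in M n -> `|g m| <= eps n) -> eps @ \oo --> 0 ->
  series (g \o regroup M) @ \oo --> y.
Proof.
move=> sM cM gM e0.
have E q j : (j < K)%N -> regroup M (q * K + j)%N = nth t0 (M q) j.
  by move=> jK; rewrite /regroup divnMDl// divn_small// addn0 modnMDl modn_small.
have S1 q : \sum_(0 <= i < q * K) g (regroup M i) = series (fun n => \sum_(m <- M n) g m) q.
  elim: q => [|q IH]; first by rewrite /series/= !big_geq.
  rewrite (_ : series _ q.+1 = series (fun n => \sum_(m <- M n) g m) q +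
    \sum_(m <- M q) g m); last by rewrite /series/= big_nat_recr.
  rewrite -IH.
  rewrite (@big_cat_nat _ _ _ (q * K)%N)//= ?leq_mul2r ?leqnSn ?orbT//; congr +%R.
  rewrite -{1}[(q * K)%N]add0n mulSn big_addn addnK (big_nth t0) sM.
  by apply: eq_big_nat => i /andP[_ iK]; rewrite addnC E.
have S2 N : series (g \o regroup M) N = series (fun n => \sum_(m <- M n) g m) (N %/ K)%N
    + \sum_(0 <= j < N %% K) g (nth t0 (M (N %/ K)%N) j).
  rewrite -S1 /series/= {1}(divn_eq N K).
  rewrite (@big_cat_nat _ _ _ (N %/ K * K)%N)//= ?leq_addr//; congr +%R.
  rewrite addnC -{1}[(N %/ K * K)%N]add0n big_addn addnK.
  apply: eq_big_nat => i /andP[_ iK]; rewrite addnC E//.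
  by rewrite (ltn_trans iK)// ltn_mod.
have cdiv : (fun N => (N %/ K)%N) @ \oo --> \oo.
  move=> A [n _ nA]; exists (n * K)%N => // N /= nN; apply: nA => /=.
  by rewrite leq_divRL.
rewrite (_ : series _ = fun N => series (fun n => \sum_(m <- M n) g m) (N %/ K)%N
    + \sum_(0 <= j < N %% K) g (nth t0 (M (N %/ K)%N) j)); last by apply/funext.
rewrite -[y]addr0; apply: cvgD; first exact: (cvg_comp _ _ cdiv cM).
have e1 : (fun N => K%:R * eps (N %/ K)%N) @ \oo --> 0.
  rewrite -(mulr0 K%:R); apply: cvgM; first exact: cvg_cst.
  exact: (cvg_comp _ _ cdiv e0).
apply/cvgr0Pnorm_le => e /= epos.
move/cvgr0Pnorm_le: e1 => /(_ e epos); apply: filterS => N.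
apply: le_trans; rewrite (le_trans (ler_norm_sum _ _ _))//.
rewrite (le_trans _ (ler_norm _))//.
apply: (@le_trans _ _ (\sum_(0 <= j < N %% K) eps (N %/ K)%N)).
  rewrite big_nat_cond [leRHS]big_nat_cond; apply: ler_sum => j.
  rewrite andbT => /andP[_ jK]; apply: gM; rewrite mem_nth// sM.
  by rewrite (ltn_trans jK)// ltn_mod.
rewrite sumr_const_nat subn0 -[leLHS]mulr_natl ler_wpM2r ?ler_nat//; last first.
  by rewrite ltnW// ltn_mod.
have /(_ _ (mem_nth t0 _)) := gM (N %/ K)%N; rewrite sM => /(_ 0%N K0).
exact: le_trans.
Qed.

End Flatten.

Section Domination.
Variables (R : realType) (I : choiceType).

Lemma ell2_abs_summable (x : ell2 R I) : (ell2_sum (fun i => qreal `|x i|) < +oo)%E.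
Proof.
rewrite /ell2_sum; under eq_esum do rewrite qnorm_qreal normr_id.
exact: coord_summable.
Qed.

(** The entries are replaced by their norms before adding, so that no cancellation can occur. *)
Lemma ell2_dominate (x y : ell2 R I) : exists u : ell2 R I,
  forall i, `|x i| <= `|u i| /\ `|y i| <= `|u i|.
Proof.
exists (Ell2 (ell2_abs_summable x) + Ell2 (ell2_abs_summable y)) => i.
rewrite coordD /=.
have -> : qreal `|x i| + qreal `|y i| = qreal (`|x i| + `|y i|).
  by congr Quat; rewrite /= ?addr0.
by rewrite qnorm_qreal ger0_norm ?addr_ge0// lerDl lerDr !normr_ge0.
Qed.

Lemma mprod_norm_le (l : seq (I * quat R)) (z u : ell2 R I) :
  (forall i, `|z i| <= `|u i|) -> `|mprod l z| <= `|mprod l u|.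
Proof.
move=> zu; elim: l => [|s l IH]; rewrite /mprod ?big_nil// !big_cons !qnormM.
by rewrite ler_pM ?mulr_ge0// ler_wpM2r.
Qed.

End Domination.

(** * The Leibniz rule for noncommutative monomials *)

Section DerivedMonomials.
Variables (R : realType) (I I' : choiceType).
Local Notation mono := (quat R * seq (I' * quat R))%type.
Variables (bc : I -> I') (ins : I -> mono -> mono) (e : nat).
Variables (bz hv : ell2 R I' -> ell2 R I).
Hypothesis bzE : forall Z s, bz Z s = Z (bc s).
Hypothesis ins_size : forall s m, size (ins s m).2 = (e + size m.2)%N.
Hypothesis ins_eval : forall s m Z, qmonomial (ins s m) Z = hv Z s * qmonomial m Z.

Definition lift_letters (l : seq (I * quat R)) := [seq (bc s.1, s.2) | s <- l].

Lemma lift_lettersE l Z : mprod (lift_letters l) Z = mprod l (bz Z).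
Proof. by rewrite /mprod big_map; apply: eq_bigr => s _; rewrite bzE. Qed.

Definition cmul (a : quat R) (m : mono) : mono := (a * m.1, m.2).
Definition vmul (s : I) (m : mono) : mono := (1, (bc s, m.1) :: m.2).

Lemma cmulE a m Z : qmonomial (cmul a m) Z = a * qmonomial m Z.
Proof. by rewrite /qmonomial /= mulrA. Qed.
Lemma vmulE s m Z : qmonomial (vmul s m) Z = bz Z s * qmonomial m Z.
Proof. by rewrite /qmonomial /= big_cons mul1r bzE mulrA. Qed.

(** [ins] covers both kinds of directions: a fibre coordinate adds a letter to the monomial
    ([e = 1]), a constant direction is absorbed into the coefficient ([e = 0]). *)
Fixpoint leibniz (l : seq (I * quat R)) : seq mono :=
  if l is s :: l' then
    ins s.1 (s.2, lift_letters l') :: [seq vmul s.1 (cmul s.2 m) | m <- leibniz l']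
  else [::].

Lemma size_leibniz l : size (leibniz l) = size l.
Proof. by elim: l => //= s l IH; rewrite size_map IH. Qed.

(** An empty [l] has no derived monomials, so the predecessor is only taken at a positive length. *)
Lemma leibniz_size l m : m \in leibniz l -> size m.2 = (e + (size l).-1)%N.
Proof.
elim: l m => //= s l IH m; rewrite inE => /orP[/eqP ->|/mapP[m' m'l ->]].
  by rewrite ins_size size_map.
by rewrite /= (IH _ m'l); case: l m'l {IH} => //= s' l _; rewrite addnS.
Qed.

Lemma leibniz_sum l Z :
  \sum_(m <- leibniz l) qmonomial m Z = dprod l (bz Z) (hv Z).
Proof.
elim: l => [|s l IH] /=; first by rewrite big_nil.
rewrite big_cons ins_eval big_map /= addrC -IH; congr +%R.
  by rewrite !mulr_sumr; apply: eq_bigr => m _; rewrite vmulE cmulE.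
by rewrite {1}/qmonomial /= -lift_lettersE.
Qed.

Lemma leibniz_norm l Z (u : ell2 R I) m : m \in leibniz l ->
  (forall i, `|bz Z i| <= `|u i| /\ `|hv Z i| <= `|u i|) ->
  `|qmonomial m Z| <= `|mprod l u|.
Proof.
move=> + H; elim: l m => //= s l IH m; rewrite inE.
rewrite {1}/mprod big_cons -/(mprod l u) [leRHS]qnormM [X in _ <= X * _]qnormM.
move=> /orP[/eqP ->|/mapP[m' m'l ->]].
  rewrite ins_eval {1}/qmonomial /= -/(mprod _ Z) lift_lettersE !qnormM mulrA.
  rewrite ler_pM ?mulr_ge0// ?ler_wpM2r// ?(H s.1).2//.
  by apply: mprod_norm_le => i; have [] := H i.
rewrite vmulE cmulE [leLHS]qnormM [X in _ * X <= _]qnormM mulrA.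
rewrite ler_pM ?mulr_ge0// ?ler_wpM2r// ?(H s.1).1//.
exact: IH.
Qed.

Definition leibniz_mono (m : quat R * seq (I * quat R)) :=
  [seq cmul m.1 m' | m' <- leibniz m.2].

Lemma size_leibniz_mono m : size (leibniz_mono m) = size m.2.
Proof. by rewrite size_map size_leibniz. Qed.

Lemma leibniz_mono_size m m' : m' \in leibniz_mono m ->
  size m'.2 = (e + (size m.2).-1)%N.
Proof. by move=> /mapP[m'' mm'' ->]; exact: (leibniz_size mm''). Qed.

Lemma leibniz_mono_sum m Z :
  \sum_(m' <- leibniz_mono m) qmonomial m' Z = dmono m (bz Z) (hv Z).
Proof.
rewrite big_map /dmono -leibniz_sum mulr_sumr.
by apply: eq_bigr => m' _; rewrite cmulE.
Qed.

Lemma leibniz_mono_norm m Z (u : ell2 R I) m' : m' \in leibniz_mono m ->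
  (forall i, `|bz Z i| <= `|u i| /\ `|hv Z i| <= `|u i|) ->
  `|qmonomial m' Z| <= `|qmonomial m u|.
Proof.
move=> /mapP[m'' mm'' ->] H; rewrite cmulE [leLHS]qnormM [leRHS]qnormM ler_wpM2l//.
exact: leibniz_norm.
Qed.

End DerivedMonomials.

Section TangentHomogeneous.
Variables (R : realType) (d : model).
Local Notation X := (qspace R d).
Local Notation X2 := (qspace R (tangent_model d)).
Local Notation I := (coords d).
Local Notation I2 := (coords (tangent_model d)).

(* The grouped series converges, but the series of single monomials has to. As
   the norm is multiplicative, each monomial of a group is dominated by the term
   it comes from, taken at a point [u] that dominates both arguments; and these
   terms tend to [0]. *)
Lemma dhom_leibniz p (P : X -> X) k (ins : I -> quat R * seq (I2 * quat R) ->
    quat R * seq (I2 * quat R)) (e : nat) (hv : X2 -> X) m :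
  (forall s m Z, qmonomial (ins s m) Z = hv Z s * qmonomial m Z) ->
  (forall n, size (m n).2 = p) ->
  (forall z, series (fun n => qmonomial (m n) z) @ \oo --> P z k) ->
  forall Z, series (fun n => \sum_(m' <- leibniz_mono (@base_coord d) ins (m n))
    qmonomial m' Z) @ \oo --> dhom p P (base_part Z) (hv Z) k /\
  exists2 eps : nat -> R, eps @ \oo --> 0 &
    forall n m', m' \in leibniz_mono (@base_coord d) ins (m n) ->
      `|qmonomial m' Z| <= eps n.
Proof.
move=> insE sm cm Z; split.
  rewrite (_ : (fun n => _) = fun n => dmono (m n) (base_part Z) (hv Z)).
    exact: dhom_series.
  by apply/funext => n; rewrite (@leibniz_mono_sum _ _ _ _ _ (@base_part R d) hv).
have [u uE] := ell2_dominate (base_part Z) (hv Z).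
exists (fun n => `|qmonomial (m n) u|); last first.
  by move=> n m' mm; apply: (@leibniz_mono_norm _ _ _ _ _ (@base_part R d) hv) => // i.
rewrite -(@normr0 _ (quat R)); apply: cvg_norm.
by apply: cvg_series_cvg_0; apply: cvgP (cm u).
Qed.

(** These are the terms of degree [p] of the tangent map. In the constant direction [eta],
    differentiation lowers the degree, so the contribution comes from degree [p.+1]; when the
    direction is the fibre variable, the lost letter is replaced by a fibre coordinate and the
    degree stays [p]. A monomial of degree [q] has [q] derived ones, whence groups of size
    [p.+1 + p]. *)
Lemma tangent_homogeneous p (P P' : X -> X) (eta : X) :
  qhomogeneous p P -> qhomogeneous p.+1 P' ->
  qhomogeneous p (fun Z : X2 => join (P (base_part Z))
    (dhom p.+1 P' (base_part Z) eta + dhom p P (base_part Z) (vect_part Z))).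
Proof.
move=> hP hP'; apply: tangent_coordP => k.
  have [m [sm cm]] := hP k.
  exists (fun n => ((m n).1, lift_letters (@base_coord d) (m n).2)); split => [n|Z].
    by rewrite size_map.
  rewrite join_base (_ : (fun n => _) = fun n => qmonomial (m n) (base_part Z)).
    exact: cm.
  apply/funext => n; rewrite !qmonomialE.
  by rewrite (@lift_lettersE _ _ _ _ (@base_part R d)).
have [m [sm cm]] := hP k; have [m' [sm' cm']] := hP' k.
pose iv (s : I) (m : quat R * seq (I2 * quat R)) := (1 : quat R, (vect_coord s, m.1) :: m.2).
pose ic (s : I) (m : quat R * seq (I2 * quat R)) := (eta s * m.1, m.2).
have ivE s m0 Z : qmonomial (iv s m0) Z = vect_part Z s * qmonomial m0 Z.
  by rewrite /qmonomial /= big_cons mul1r mulrA.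
have icE s m0 Z : qmonomial (ic s m0) Z = eta s * qmonomial m0 Z.
  by rewrite /qmonomial /= mulrA.
pose M n := leibniz_mono (@base_coord d) ic (m' n) ++ leibniz_mono (@base_coord d) iv (m n).
have sM n : size (M n) = (p.+1 + p)%N.
  by rewrite size_cat !size_leibniz_mono sm' sm.
exists (regroup (0, [::]) (p.+1 + p) M); split=> [n|Z].
  have : regroup (0, [::]) (p.+1 + p) M n \in M (n %/ (p.+1 + p))%N.
    by apply: mem_nth; rewrite sM ltn_mod.
  rewrite mem_cat => /orP[] H.
    by rewrite (@leibniz_mono_size _ _ _ _ _ 0 _ _ _ H) ?sm'.
  rewrite (@leibniz_mono_size _ _ _ _ _ 1 _ _ _ H) ?sm//.
  (* For [p = 0] the formula [1 + p.-1] would be wrong, but then there is no derived monomial to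
     consider. *)
  by case: (p) sm H => [|//] s0; rewrite /leibniz_mono (size0nil (s0 _)).
have [c' [eps' e'0 b']] := @dhom_leibniz _ _ _ _ 0 (fun=> eta) _ icE sm' cm' Z.
have [c [eps e0 b]] := @dhom_leibniz _ _ _ _ 1 (@vect_part R d) _ ivE sm cm Z.
rewrite join_vect coordD.
apply: (@regroup_series _ _ _ _ _ _ M (fun m => qmonomial m Z)
  (fun n => `|eps' n| + `|eps n|)) => //.
- rewrite (_ : (fun n => _) = fun n =>
    \sum_(m0 <- leibniz_mono (@base_coord d) ic (m' n)) qmonomial m0 Z +
    \sum_(m0 <- leibniz_mono (@base_coord d) iv (m n)) qmonomial m0 Z); last first.
    by apply/funext => n; rewrite big_cat.
  rewrite (_ : series _ = fun n => series (fun n =>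
    \sum_(m0 <- leibniz_mono (@base_coord d) ic (m' n)) qmonomial m0 Z) n + series (fun n =>
    \sum_(m0 <- leibniz_mono (@base_coord d) iv (m n)) qmonomial m0 Z) n); last first.
    by apply/funext => n; rewrite /series/= big_split.
  exact: cvgD.
- move=> n m0; rewrite mem_cat => /orP[] H.
    by rewrite (le_trans (b' _ _ H))// (le_trans (ler_norm _))// lerDl.
  by rewrite (le_trans (b _ _ H))// (le_trans (ler_norm _))// lerDr.
- rewrite -[0]addr0; apply: cvgD; rewrite -(@normr0 _ R); exact: cvg_norm.
Qed.

End TangentHomogeneous.

(** * Termwise differentiation of power series *)

Section PowerSeries.
Variables (R : realType) (I J : choiceType).
Implicit Types (f : ell2 R I -> ell2 R J) (z h zeta : ell2 R I).

(** The body of [qanalytic_at] with its witnesses exposed. *)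
Definition power_series f zeta (r : R) (P : nat -> ell2 R I -> ell2 R J) (b : nat -> R) :=
  [/\ 0 < r, forall p, qhomogeneous p (P p),
      forall p z, `|z| < r -> `|P p z| <= b p, cvgn (series b) &
      forall z, `|z| < r -> series (fun p => P p z) @ \oo --> f (zeta + z)].

Lemma power_series_ge0 f zeta r P b : power_series f zeta r P b -> forall p, 0 <= b p.
Proof. by move=> [r0 _ Pb _ _] p; apply: le_trans (Pb p 0 _); rewrite ?normr0. Qed.

Lemma power_series_restrict f zeta r r' P b : 0 < r' -> r' <= r ->
  power_series f zeta r P b -> power_series f zeta r' P b.
Proof.
move=> r'0 r'r [r0 hP Pb cb Pf]; split => // [p z zr|z zr].
  by apply: Pb; exact: lt_le_trans r'r.
by apply: Pf; exact: lt_le_trans r'r.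
Qed.

(** Homogeneity turns a bound on a ball into a bound everywhere, of order [p] at the origin. *)
Lemma homog_bound p (P : ell2 R I -> ell2 R J) (rho b : R) : 0 < rho ->
  qhomogeneous p P -> (forall z, `|z| <= rho -> `|P z| <= b) ->
  forall z, `|P z| <= (`|z| / rho) ^+ p * b.
Proof.
move=> rho0 hP Pb z; have b0 : 0 <= b by apply: le_trans (Pb 0 _); rewrite ?normr0 ?(ltW rho0).
have [->|z0] := eqVneq z 0.
  case: p hP => [|p] hP; first by rewrite expr0 mul1r Pb ?normr0 ?(ltW rho0).
  by rewrite (homog0 hP)// !normr0 mul0r expr0n mul0r.
have nz : `|z| != 0 by rewrite normr_eq0.
have zE : z = (`|z| / rho) *: ((rho / `|z|) *: z).
  by rewrite scalerA mulrA divfK ?gt_eqF// divff// scale1r.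
rewrite [in leLHS]zE (homog_scale _ _ hP) normrZ ler_pM//.
  by rewrite ger0_norm// exprn_ge0// divr_ge0 ?(ltW rho0).
rewrite Pb// normrZ ger0_norm ?divr_ge0 ?(ltW rho0)//.
by rewrite divfK.
Qed.

Lemma limn_seriesZ (b : nat -> R) (c : R) : cvgn (series b) ->
  series (fun p => c * b p) @ \oo --> c * limn (series b).
Proof.
move=> cb; rewrite (_ : series _ = (fun n => c * series b n)).
  by apply: cvgM => //; exact: cvg_cst.
by apply/funext => n; rewrite /series/= mulr_sumr.
Qed.

(** On a small ball all terms of degree at least [2] are bounded by [(|h| / rho) ^ 2] times [b], so
    that the remainder after the linear term is quadratic in [h]. *)
Lemma power_series_fder f zeta r P b : power_series f zeta r P b ->
  is_fder f zeta (P 1%N).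
Proof.
(* The radius is halved below because [homog_bound] wants a closed ball while [Pb] holds on an open
   one. *)
move=> psf; have b0 := power_series_ge0 psf; case: psf => r0 hP Pb cb Pf.
pose rho := r / 2; have rho0 : 0 < rho by rewrite divr_gt0.
have Pr p z : `|P p z| <= (`|z| / rho) ^+ p * b p.
  apply: homog_bound => // y yr; apply: Pb; rewrite (le_lt_trans yr)//.
  by rewrite /rho; lra.
have f0 : f zeta = P 0%N 0.
  have := Pf 0; rewrite normr0 addr0 => /(_ r0) f0.
  apply: (cvg_unique _ f0); first exact: norm_hausdorff.
  apply: cvg_near_cst; exists 1%N => // n /= n1.
  rewrite /series/= (big_ltn n1) big_nat_cond big1 ?addr0// => p /andP[/andP[p1 _] _].
  by rewrite (homog0 (hP p)).
split.
- by move=> a u v; exact: homog1_linear.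
- exists (rho^-1 * b 1%N) => v; rewrite (le_trans (Pr _ _))// expr1.
  by rewrite le_eqVlt; apply/orP; left; apply/eqP; ring.
move=> e e0; pose B := limn (series b).
have B0 : 0 <= B by apply: le_trans (series_le_lim b0 cb 0); rewrite /series/= big_geq.
near=> h.
have hr : `|h| <= rho.
  near: h; apply/nbhs_ballP; exists rho => // y.
  by rewrite -ball_normE/= sub0r normrN => /ltW.
have hr' : `|h| < r by rewrite (le_lt_trans hr)// /rho; lra.
set c := (`|h| / rho) ^+ 2.
have hb p : (2 <= p)%N -> `|P p h| <= c * b p.
  move=> p2; rewrite (le_trans (Pr _ _))// ler_wpM2r//.
  have h1 : `|h| / rho <= 1 by rewrite ler_pdivrMr// mul1r.
  by rewrite /c; apply: ler_wiXn2l => //; rewrite divr_ge0 ?(ltW rho0).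
have cs := @limn_seriesZ b c cb.
have := series_near _ (cvgP _ cs) (Pf h hr') hb.
rewrite (cvg_lim _ cs)//.
have -> : series (fun p => P p h) 2%N = f zeta + P 1%N h.
  by rewrite /series/= big_nat_recr//= big_nat1 (homog_const h (hP 0%N)) f0.
move=> /(_ (fun p => mulr_ge0 (sqr_ge0 _) (b0 p))) H.
rewrite -addrA -opprD (le_trans H)//.
apply: (@le_trans _ _ (c * B)).
  by rewrite gerBl; apply: sumr_ge0 => p _; rewrite mulr_ge0// sqr_ge0.
rewrite /c expr2.
have hB : `|h| * B <= e * rho ^+ 2.
  have : `|h| <= e * rho ^+ 2 / (B + 1).
    near: h; apply/nbhs_ballP; exists (e * rho ^+ 2 / (B + 1)).
      by rewrite /= divr_gt0 ?mulr_gt0 ?exprn_gt0// ltr_wpDl.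
    by move=> y; rewrite -ball_normE/= sub0r normrN => /ltW.
  rewrite ler_pdivlMr ?ltr_wpDl// => /(le_trans _); apply.
  by rewrite ler_wpM2l// lerDl.
have -> : `|h| / rho * (`|h| / rho) * B = (`|h| * B) / rho ^+ 2 * `|h|.
  by field; rewrite gt_eqF.
by rewrite ler_wpM2r// ler_pdivrMr ?exprn_gt0.
Unshelve. all: by end_near. Qed.

(** Reduction to one real variable: [termwise_derivative] is applied to
    [t |-> chi (f (zeta + (z + t *: h)) k)]. The bound on [|z| + |h|] keeps the whole segment
    [|t| <= 1] in the ball where [dhom_norm] holds. *)
Lemma coord_termwise f zeta r P b z h L (chi : quat R -> R) k :
  power_series f zeta r P b ->
  (forall (a : R) x y, chi (a *: x + y) = a * chi x + chi y) ->
  (forall x, `|chi x| <= `|x|) ->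
  is_fder f (zeta + z) L -> `|z| + `|h| < r / 10 ->
  forall N, `|chi (L h k - series (fun p => dhom p (P p) z h) N k)| <=
    limn (series b) - series b N.
Proof.
move=> psf chiL chin fL zhr N; case: (psf) => r0 hP Pb cb Pf.
have chiZ a x : chi (a *: x) = a * chi x.
  exact: (@raw_linearZ _ _ R^o chi chiL).
have chiB x y : chi (x - y) = chi x - chi y.
  by rewrite addrC -scaleN1r chiL mulN1r addrC.
have /choice[G HG] : forall p, exists G : {poly R}, forall t,
    chi (P p (z + t *: h) k) = G.[t] /\ chi (dhom p (P p) (z + t *: h) h k) = G^`().[t].
  by move=> p; apply: homog_poly.
have zr t : `|t| <= 1 -> `|z + t *: h| < r / 10.
  move=> t1; apply: le_lt_trans zhr; rewrite (le_trans (ler_normD _ _))//.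
  by rewrite lerD2l normrZ ler_piMl.
have hr : `|h| < r / 10 by apply: le_lt_trans zhr; rewrite lerDr.
have r10 : r / 10 < r by lra.
have chi_series (F : nat -> ell2 R J) n :
    chi (series F n k) = series (fun p => chi (F p k)) n.
  rewrite /series/= coord_sum; elim: n => [|n IH].
    by rewrite !big_geq// -(scale0r 0) chiZ mul0r.
  by rewrite !big_nat_recr//= -[X in chi (X + _)]scale1r chiL mul1r IH.
rewrite chiB chi_series.
rewrite (_ : (fun p => chi _) = fun p => (G p)^`().[0]); last first.
  by apply/funext => p; have [_ <-] := HG p 0; rewrite scale0r addr0.
apply: (@termwise_derivative _ G b (fun t => chi (f (zeta + (z + t *: h)) k))) => //.
- move=> p t t1; have [_ <-] := HG p t.
  rewrite (le_trans (chin _))// (le_trans (norm_coord_le _ _))//.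
  by apply: (dhom_norm r0 (hP p) (Pb p)) => //; exact: zr.
- move=> t t1.
  rewrite (_ : series _ = fun n => chi (series (fun p => P p (z + t *: h)) n k)); last first.
    apply/funext => n; rewrite chi_series; congr (series _ _).
    by apply/funext => p; have [<- _] := HG p t.
  have Pt := Pf _ (lt_trans (zr t t1) r10).
  apply/cvgrPdist_le => e e0; move/cvgrPdist_le: Pt => /(_ e e0); apply: filterS => n.
  apply: le_trans; rewrite -chiB (le_trans (chin _))//.
  by rewrite -coordN -coordD norm_coord_le.
- move=> e e0; have [Llin _ Le] := fL.
  (* The estimate of the derivative is relative to [t *: h]; dividing by [|h| + 1] makes it relative
     to [t], including the case [h = 0]. *)
  pose e' := e / (`|h| + 1).
  have h1 : 0 < `|h| + 1 by rewrite ltr_wpDl.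
  have e'0 : 0 < e' by rewrite divr_gt0.
  have LZ t : L (t *: h) = t *: L h by exact: raw_linearZ.
  have ct : (fun t : R => t *: h) @ (0 : R) --> (0 : ell2 R I).
    by rewrite -[X in _ --> X](scale0r h); apply: cvgZr_tmp; exact: cvg_id.
  have Ht : \forall t \near (0 : R), `|f (zeta + z + t *: h) - f (zeta + z) -
      L (t *: h)| <= e' * `|t *: h| by exact: (ct _ (Le _ e'0)).
  apply: filterS Ht => t.
  rewrite LZ scale0r addr0 addrA => H.
  rewrite -chiZ -!chiB -coordZ -!coordN -!coordD.
  rewrite (le_trans (chin _))// (le_trans (norm_coord_le _ _))// (le_trans H)//.
  rewrite normrZ [leLHS](_ : _ = e * `|t| * (`|h| / (`|h| + 1))).
    by rewrite ler_piMr ?mulr_ge0 ?(ltW e0)// ler_pdivrMr// mul1r lerDl.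
  by rewrite /e'; ring.
Qed.

End PowerSeries.

Section DerivativeSeries.
Variables (R : realType) (I J : choiceType).
Implicit Types (f : ell2 R I -> ell2 R J) (z h zeta : ell2 R I).

Lemma derivative_series_small f zeta r P b z h L : power_series f zeta r P b ->
  is_fder f (zeta + z) L -> `|z| + `|h| < r / 10 ->
  series (fun p => dhom p (P p) z h) @ \oo --> L h.
Proof.
move=> psf fL zhr; have b0 := power_series_ge0 psf; case: (psf) => r0 hP Pb cb Pf.
set S := series _; pose tau N := limn (series b) - series b N.
have tau0 : tau @ \oo --> 0 by exact: tail_cvg0.
have zr : `|z| < r / 10 by apply: le_lt_trans zhr; rewrite lerDl.
have hr : `|h| < r / 10 by apply: le_lt_trans zhr; rewrite lerDr.
have Sk k : (fun N => S N k) @ \oo --> L h k.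
  (* Each of the four real components of the coordinate contributes [tau N]. *)
  have t4 : (fun N => 4 * tau N) @ \oo --> 0.
    by rewrite -(mulr0 4); apply: cvgM => //; exact: cvg_cst.
  apply/cvgrPdist_le => e e0; move/cvgr0Pnorm_le: t4 => /(_ e e0); apply: filterS => N.
  apply: le_trans; rewrite (le_trans _ (ler_norm _))// (le_trans (qnorm_le_comp _))//.
  rewrite (_ : 4 * tau N = tau N + tau N + tau N + tau N); last by ring.
  have H chi := @coord_termwise _ _ _ f zeta r P b z h L chi k psf.
  by rewrite !lerD//; apply: H => //; try (by move=> a [????] [????]);
    move=> x; have [] := qcomp_le x.
(* From coordinates to the norm: [dhom_norm] bounds [S M - S N] by [tau N] for all [M >= N], and
   [ell2_norm_lim] lets [M] tend to infinity. *)
have bS N : `|L h - S N| <= tau N.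
  apply: (@ell2_norm_lim _ _ (fun M => S M - S N)) => [i|].
    by rewrite coordD coordN; apply: cvgB; [exact: Sk|exact: cvg_cst].
  exists N => // M /= NM; rewrite sub_series_geq// (le_trans (ler_norm_sum _ _ _))//.
  rewrite (le_trans _ (sum_le_tail b0 cb N M))//.
  by apply: ler_sum => p _; exact: dhom_norm r0 (hP p) (Pb p) zr hr.
apply/cvgrPdist_le => e e0; move/cvgr0Pnorm_le: tau0 => /(_ e e0); apply: filterS => N.
by apply: le_trans; rewrite (le_trans (bS N))// ler_norm.
Qed.

Lemma derivative_series f zeta r P b z h L : power_series f zeta r P b ->
  is_fder f (zeta + z) L -> `|z| < r / 10 ->
  series (fun p => dhom p (P p) z h) @ \oo --> L h.
Proof.
move=> psf fL zr; have [r0 hP _ _ _] := psf; have [Llin _ _] := fL.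
(* Both sides are homogeneous in [h], so [h] may be shrunk until [|z| + |c *: h| < r / 10]. *)
pose c := (r / 10 - `|z|) / (`|h| + 1) / 2.
have h1 : 0 < `|h| + 1 by rewrite ltr_wpDl.
have c0 : 0 < c by rewrite !divr_gt0// subr_gt0.
have chr : `|z| + `|c *: h| < r / 10.
  rewrite addrC -ltrBrDr normrZ gtr0_norm//.
  have -> : c * `|h| = (r / 10 - `|z|) * (`|h| / (`|h| + 1) / 2).
    by rewrite /c; field; rewrite gt_eqF.
  rewrite gtr_pMr ?subr_gt0//.
  have : `|h| / (`|h| + 1) <= 1 by rewrite ler_pdivrMr// mul1r lerDl.
  lra.
have := derivative_series_small psf fL chr; rewrite (raw_linearZ Llin) => H.
have cn0 : c != 0 by rewrite gt_eqF.
rewrite -[L h]scale1r -(mulVf cn0) -scalerA.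
rewrite (_ : series _ = fun n => c^-1 *: series (fun p => dhom p (P p) z (c *: h)) n).
  exact: cvgZr.
apply/funext => n; rewrite /series/= scaler_sumr; apply: eq_bigr => p _.
by rewrite (dhom_scale _ _ _ (hP p)) scalerA mulVf ?scale1r// gt_eqF.
Qed.

End DerivativeSeries.

Lemma series_shift (R : realType) (V : normedModType R) (u : nat -> V) l :
  series u @ \oo --> l -> series (fun p => u p.+1) @ \oo --> l - u 0%N.
Proof.
move=> ul; rewrite (_ : series _ = fun n => series u n.+1 - u 0%N).
  by apply: cvgB; [rewrite cvg_shiftS|exact: cvg_cst].
by apply/funext => n; rewrite /series/= (big_nat_recl n)//= addrC addKr.
Qed.

Lemma join_cvg (R : realType) (d : model) (T : Type) (F : set_system T)
    (FF : Filter F) (u v : T -> qspace R d) a b :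
  u @ F --> a -> v @ F --> b -> (fun t => join (u t) (v t)) @ F --> join a b.
Proof.
move=> /cvgrPdist_le ua /cvgrPdist_le vb; apply/cvgrPdist_le => e e0.
have e2 : 0 < e / 2 by rewrite divr_gt0.
near=> t; rewrite -joinN -joinD (le_trans (join_norm _ _))// [leRHS]splitr.
by rewrite lerD//; near: t; [exact: ua|exact: vb].
Unshelve. all: by end_near. Qed.

(** * Analyticity of the tangent map *)

Section TangentMap.
Variables (R : realType) (d : model).
Local Notation X := (qspace R d).
Local Notation X2 := (qspace R (tangent_model d)).
Implicit Types (f : X -> X) (U : set X).

Definition tangent_map f (Z : X2) : X2 :=
  join (f (base_part Z)) ('d f (base_part Z) (vect_part Z)).

Lemma qholomorphic_fder f U x : qholomorphic U f -> U x ->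
  is_fder f x ('d f x).
Proof.
move=> fU Ux; have [r [P [b psf]]] := fU x Ux.
have H := power_series_fder psf; have [_ dE] := is_fder_diff H.
by rewrite dE.
Qed.

Lemma dhom0 (P : X -> X) z h : qhomogeneous 0 P -> dhom 0 P z h = 0.
Proof.
move=> hP; apply: ell2P => k; rewrite dhom_coord.
have [_ en _] := nodesP R 0; have [a Ha] := homog_coefs z h k hP.
by rewrite (extract_coef en Ha) (proj1 Ha).
Qed.

Lemma tangent_map_holomorphic f U : open U -> qholomorphic U f ->
  qholomorphic (@base_part R d @^-1` U) (tangent_map f).
Proof.
move=> oU fU Z0 /= UZ.
have [r1 [P [b psf1]]] := fU _ UZ.
have [r2 /= r20 Ur2] : nbhs_ball (base_part Z0) U.
  by apply/nbhs_ballP; exact: open_nbhs_nbhs.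
(* Within [r2] the displaced base point stays in [U], where [f] is known to have a derivative. *)
pose r := Num.min r1 r2.
have r10 : 0 < r1 by case: psf1.
have r0 : 0 < r by rewrite lt_min r10.
have psf : power_series f (base_part Z0) r P b.
  by apply: power_series_restrict psf1 => //; rewrite ge_min lexx.
have b0 := power_series_ge0 psf; case: (psf) => _ hP Pb cb Pf.
set eta := vect_part Z0.
(* The direction [eta] may be large, whereas [dhom_norm] wants a small one; shrinking it by [lam]
   costs the factor [lam^-1] in the bound. *)
pose lam := r / 10 / (`|eta| + 1).
have e1 : 0 < `|eta| + 1 by rewrite ltr_wpDl.
have lam0 : 0 < lam by rewrite !divr_gt0.
have leta : `|lam *: eta| < r / 10.
  rewrite normrZ gtr0_norm// /lam mulrAC -mulrA gtr_pMr ?divr_gt0//.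
  by rewrite ltr_pdivrMr// mul1r ltrDl.
have etaE : eta = lam^-1 *: (lam *: eta) by rewrite scalerA mulVf ?scale1r// gt_eqF.
pose Q p (Z : X2) := join (P p (base_part Z))
    (dhom p.+1 (P p.+1) (base_part Z) eta + dhom p (P p) (base_part Z) (vect_part Z)).
pose b' p := b p + (lam^-1 * b p.+1 + b p).
exists (r / 10), Q, b'; split.
- by rewrite divr_gt0.
- by move=> p; exact: tangent_homogeneous.
- move=> p Z Zr.
  have bZr : `|base_part Z| < r / 10 by exact: le_lt_trans (base_norm _) Zr.
  have vZr : `|vect_part Z| < r / 10 by exact: le_lt_trans (vect_norm _) Zr.
  rewrite (le_trans (join_norm _ _))// lerD//.
    by rewrite Pb// (lt_trans bZr)//; lra.
  rewrite (le_trans (ler_normD _ _))// lerD//; last first.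
    exact: dhom_norm r0 (hP p) (Pb p) bZr vZr.
  rewrite {1}etaE (dhom_scale _ _ _ (hP _)) normrZ gtr0_norm ?invr_gt0//.
  rewrite ler_wpM2l ?invr_ge0 ?(ltW lam0)//.
  exact: dhom_norm r0 (hP _) (Pb _) bZr leta.
- have cvb := cvgP _ (series_shift cb).
  rewrite (_ : series _ = fun n => series b n +
    (lam^-1 * series (fun p => b p.+1) n + series b n)).
    by apply: is_cvgD => //; apply: is_cvgD => //; apply: is_cvgMr.
  by apply/funext => n; rewrite /series/= !big_split/= mulr_sumr.
- move=> Z Zr.
  have bZr : `|base_part Z| < r / 10 by exact: le_lt_trans (base_norm _) Zr.
  have UZZ : U (base_part Z0 + base_part Z).
    apply: Ur2; rewrite -ball_normE/= opprD addrA subrr add0r normrN.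
    rewrite (lt_le_trans bZr)//.
    have : r <= r2 by rewrite ge_min lexx orbT.
    lra.
  have fL := qholomorphic_fder fU UZZ.
  have [Llin _ _] := fL.
  have D1 := derivative_series (h := vect_part Z) psf fL bZr.
  have D0 := derivative_series (h := eta) psf fL bZr.
  have F := Pf _ (lt_trans bZr (_ : r / 10 < r)).
  (* The shift aligns the degrees of the two series; the term it drops is the derivative of the
     constant [P 0]. *)
  have D := cvgD (series_shift D0) D1.
  rewrite (dhom0 _ _ (hP _)) subr0 in D.
  rewrite /tangent_map baseD vectD -/eta linearD.
  rewrite (_ : series _ = fun n => join (series (fun p => P p (base_part Z)) n)
     (series (fun p => dhom p.+1 (P p.+1) (base_part Z) eta) n +
      series (fun p => dhom p (P p) (base_part Z) (vect_part Z)) n)).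
    apply: join_cvg; last exact: D.
    by apply: F; lra.
  by apply/funext => n; rewrite /series/= -big_split/= join_sum.
Qed.

End TangentMap.

(** * Smoothness of the tangent map *)

Section Smoothness.
Variables (R : realType) (V W : normedModType R).

Definition smooth_jet (U : set V) (f : V -> W) (D : V -> seq V -> W) :=
  forall x, U x ->
    [/\ D x [::] = f x,
        forall s t (a : R) u v,
          D x (s ++ (a *: u + v) :: t) = a *: D x (s ++ u :: t) + D x (s ++ v :: t),
        forall k, exists C : R, forall s, size s = k ->
          `|D x s| <= C * \prod_(v <- s) `|v| &
        forall k (e : R), 0 < e -> \forall h \near (0 : V),
          forall s, size s = k ->
          `|D (x + h) s - D x s - D x (h :: s)| <= e * `|h| * \prod_(v <- s) `|v|].

Lemma near_translate (U : set V) x : open U -> U x -> \forall h \near (0 : V), U (x + h).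
Proof.
move=> oU Ux; have : \forall y \near x, U y by exact: open_nbhs_nbhs.
by rewrite (near_shift 0 x); apply: filterS => h /=; rewrite subr0 addrC.
Qed.

Lemma smooth_fder U f D x : open U -> smooth_jet U f D -> U x ->
  is_fder f x (fun h => D x [:: h]).
Proof.
move=> oU DU Ux; have [D0 Dlin Db De] := DU x Ux; split.
- by move=> a u v; exact: (Dlin [::] [::]).
- by have [C HC] := Db 1%N; exists C => v; have := HC [:: v] erefl; rewrite big_seq1.
move=> e e0; near=> h.
have Uh : U (x + h) by near: h; exact: near_translate.
have [Dh _ _ _] := DU _ Uh; rewrite -D0 -Dh.
have : forall s, size s = 0%N ->
  `|D (x + h) s - D x s - D x (h :: s)| <= e * `|h| * \prod_(v <- s) `|v|.
  by near: h; exact: De.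
by move=> /(_ [::] erefl); rewrite big_nil mulr1.
Unshelve. all: by end_near. Qed.

Lemma frechet_smooth_eq U (f g : V -> W) : (forall x, U x -> f x = g x) ->
  frechet_smooth U f -> frechet_smooth U g.
Proof.
move=> fg [D HD]; exists D => x Ux; have [D0 Dl Db De] := HD x Ux.
by split => //; rewrite D0 fg.
Qed.

End Smoothness.

Lemma prod_norm_contract (R : realType) (V V' : normedModType R) (B : V' -> V) s :
  (forall v, `|B v| <= `|v|) ->
  \prod_(v <- map B s) `|v| <= \prod_(v <- s) `|v|.
Proof.
move=> Bn; rewrite big_map; elim: s => [|v s IH]; rewrite ?big_nil// !big_cons.
by rewrite ler_pM// prodr_ge0.
Qed.

Lemma prod_norm_ge0 (R : realType) (V : normedModType R) (s : seq V) :
  0 <= \prod_(v <- s) `|v|.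
Proof. exact: prodr_ge0. Qed.

Lemma near_contract (R : realType) (V V' : normedModType R) (B : V' -> V) (Q : set V) :
  (forall v, `|B v| <= `|v|) -> (\forall h \near (0 : V), Q h) ->
  \forall h \near (0 : V'), Q (B h).
Proof.
move=> Bn /nbhs_ballP[r /= r0 Qr]; apply/nbhs_ballP; exists r => // h.
rewrite -ball_normE/= sub0r normrN => hr; apply: Qr.
by rewrite -ball_normE/= sub0r normrN (le_lt_trans (Bn _)).
Qed.

Lemma frechet_smooth_contract (R : realType) (V V' W : normedModType R)
    (B : V' -> V) (U : set V) (f : V -> W) :
  (forall (a : R) u v, B (a *: u + v) = a *: B u + B v) ->
  (forall v, `|B v| <= `|v|) ->
  frechet_smooth U f -> frechet_smooth (B @^-1` U) (f \o B).
Proof.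
move=> Blin Bn [D HD]; exists (fun x s => D (B x) (map B s)) => x /= Ux.
have [D0 Dl Db De] := HD _ Ux.
have BD u v : B (u + v) = B u + B v by have := Blin 1 u v; rewrite !scale1r.
split => //.
- by move=> s t a u v; rewrite !map_cat /= Blin Dl.
- move=> k; have [C HC] := Db k; exists `|C| => s sk.
  rewrite (le_trans (HC _ _)) ?size_map//.
  rewrite (le_trans (ler_wpM2r (prod_norm_ge0 _) (ler_norm _)))//.
  by rewrite ler_wpM2l// prod_norm_contract.
- move=> k e e0; have := near_contract Bn (De k e e0); apply: filterS => h H s sk.
  rewrite BD (le_trans (H _ _)) ?size_map//.
  rewrite ler_pM ?mulr_ge0 ?(ltW e0) ?prod_norm_ge0//.
    by rewrite ler_wpM2l ?(ltW e0).
  exact: prod_norm_contract.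
Qed.

(** The term [c'], which will be [D x (h :: sg ++ [:: v])], is subtracted and added in order to
    complete a first-order remainder of [D] in each bracket. *)
Lemma ell2_rearrange (R : realType) (I : choiceType) (a b c a' b' c' l m n : ell2 R I) :
  (a + b + l) - (a' + m) - (c + (b' + n)) =
  (a - a' - c) + ((b - b' - c') + c') + (l - m - n).
Proof.
apply: ell2P => i; rewrite !(coordD, coordN).
move: (a i) (b i) (c i) (a' i) (b' i) (c' i) (l i) (m i) (n i).
by do 9! case=> ????; congr Quat => /=; ring.
Qed.

Section TangentSmooth.
Variables (R : realType) (d : model).
Local Notation X := (qspace R d).
Local Notation X2 := (qspace R (tangent_model d)).
Local Notation base := (@base_part R d).
Local Notation vect := (@vect_part R d).

(* Leibniz rule: one of the vectors contributes its fibre part, which fills the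
   last slot; the others contribute their base parts. *)
Fixpoint leibniz_sum_vect (phi : seq X -> X) (s : seq X2) : X :=
  if s is h :: s' then
    phi (map base s' ++ [:: vect h]) +
    leibniz_sum_vect (fun l => phi (base h :: l)) s'
  else 0.

Lemma leibniz_sum_vect_norm phi (c : R) s : 0 <= c ->
  (forall l, size l = size s -> `|phi l| <= c * \prod_(v <- l) `|v|) ->
  `|leibniz_sum_vect phi s| <= (size s)%:R * (c * \prod_(v <- s) `|v|).
Proof.
elim: s phi c => [|h s IH] phi c c0 H /=; first by rewrite normr0 mul0r.
rewrite (le_trans (ler_normD _ _))// -natr1 addrC mulrDl mul1r lerD//.
  have c'0 : 0 <= c * `|base h| by rewrite mulr_ge0.
  rewrite (le_trans (IH _ _ c'0 _))//.
    by move=> l sl; rewrite (le_trans (H _ _)) /= ?sl// big_cons mulrA.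
  rewrite ler_wpM2l// big_cons mulrA ler_wpM2r ?prod_norm_ge0//.
  by rewrite ler_wpM2l// base_norm.
rewrite (le_trans (H _ _)) ?size_cat ?size_map ?addn1//.
rewrite big_cat big_seq1 big_cons ler_wpM2l// [leRHS]mulrC.
rewrite ler_pM ?prod_norm_ge0 ?vect_norm//.
by apply: prod_norm_contract; exact: base_norm.
Qed.

Lemma leibniz_sum_vectP (a : R) phi psi s :
  leibniz_sum_vect (fun l => a *: phi l + psi l) s =
  a *: leibniz_sum_vect phi s + leibniz_sum_vect psi s.
Proof.
elim: s phi psi => [|h s IH] phi psi /=; first by rewrite scaler0 addr0.
by rewrite IH scalerDr addrACA.
Qed.

Lemma leibniz_sum_vectB phi psi s :
  leibniz_sum_vect (fun l => phi l - psi l) s =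
  leibniz_sum_vect phi s - leibniz_sum_vect psi s.
Proof.
rewrite (_ : (fun l => _) = fun l => (-1) *: psi l + phi l).
  by rewrite leibniz_sum_vectP scaleN1r addrC.
by apply/funext => l; rewrite scaleN1r addrC.
Qed.

Lemma baseP (a : R) u v : base (a *: u + v) = a *: base u + base v.
Proof. by rewrite baseD baseZ. Qed.
Lemma vectP (a : R) u v : vect (a *: u + v) = a *: vect u + vect v.
Proof. by rewrite vectD vectZ. Qed.

Lemma leibniz_sum_vect_linear phi :
  (forall s t (a : R) u v,
    phi (s ++ (a *: u + v) :: t) = a *: phi (s ++ u :: t) + phi (s ++ v :: t)) ->
  forall s t (a : R) u v,
    leibniz_sum_vect phi (s ++ (a *: u + v) :: t) =
    a *: leibniz_sum_vect phi (s ++ u :: t) + leibniz_sum_vect phi (s ++ v :: t).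
Proof.
move=> + s; elim: s phi => [|h s IH] phi H t a u v /=.
  rewrite vectP H scalerDr addrACA; congr +%R.
  rewrite -leibniz_sum_vectP; congr leibniz_sum_vect; apply/funext => l.
  by rewrite baseP; exact: (H [::]).
rewrite !map_cat /= baseP -!catA /= H scalerDr addrACA; congr +%R.
by apply: IH => s' t' a' u' v'; exact: (H (base h :: s')).
Qed.

(* The [k]-th derivative of [(x, v) |-> D x [:: v]] along [s] is
   [D x (map base s ++ [:: v])] plus the Leibniz sum, whose terms come from the
   linear dependence on [v]. *)
Lemma tangent_map_smooth (U : set X) (f : X -> X) : open U ->
  frechet_smooth U f -> frechet_smooth (base @^-1` U) (tangent_map f).
Proof.
move=> oU [D HD].
pose E (Z : X2) (s : seq X2) := join (D (base Z) (map base s))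
  (D (base Z) (map base s ++ [:: vect Z]) + leibniz_sum_vect (D (base Z)) s).
exists E => Z /= UZ; have [D0 Dl Db De] := HD _ UZ; set x := base Z in UZ D0 Dl Db De *.
split.
- have [_ dE] := is_fder_diff (smooth_fder oU HD UZ).
  by rewrite /E /tangent_map /= addr0 -/x D0 dE.
- move=> s t a u v; rewrite /E -joinZ -joinD !map_cat /= baseP Dl.
  rewrite -!catA /= Dl scalerDr addrACA.
  by rewrite -leibniz_sum_vect_linear.
- move=> k; have [C HC] := Db k; have [C' HC'] := Db k.+1.
  exists (`|C| + (`|C'| * `|vect Z| + k%:R * `|C|)) => s sk.
  have HCn l : size l = k -> `|D x l| <= `|C| * \prod_(v <- l) `|v|.
    by move=> lk; rewrite (le_trans (HC _ lk))// ler_wpM2r ?prod_norm_ge0// ler_norm.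
  have pb : \prod_(v <- map base s) `|v| <= \prod_(v <- s) `|v|.
    by apply: prod_norm_contract; exact: base_norm.
  rewrite (le_trans (join_norm _ _))// mulrDl lerD//.
    by rewrite (le_trans (HCn _ _)) ?size_map// ler_wpM2l.
  rewrite (le_trans (ler_normD _ _))// mulrDl lerD//.
    rewrite (le_trans (HC' _ _)) ?size_cat ?size_map ?sk ?addn1//.
    rewrite (le_trans (ler_wpM2r (prod_norm_ge0 _) (ler_norm _)))//.
    rewrite big_cat big_seq1 -mulrA [X in _ <= _ * X]mulrC ler_wpM2l//.
    by rewrite ler_wpM2r.
  by rewrite -mulrA -sk leibniz_sum_vect_norm// => l; rewrite sk; exact: HCn.
move=> k e e0; have [C' HC'] := Db k.+2.
(* [K] adds up the coefficients of the errors [n1], [n2], [n3] and [n5], which receive half of [e];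
   the other half is for [n4]. *)
pose w := vect Z; pose K := 1 + `|w| + 1 + k%:R.
have K0 : 0 < K by rewrite /K -!addrA ltr_pwDl// !addr_ge0.
have [e1 e10 e1K] : exists2 e1, 0 < e1 & e1 * K = e / 2.
  by exists (e / 2 / K); rewrite ?divr_gt0// divfK// gt_eqF.
have Dk := near_contract (@base_norm R d) (De k e1 e10).
have Dk1 := near_contract (@base_norm R d) (De k.+1 e1 e10).
have DU := near_contract (@base_norm R d) (near_translate oU UZ).
have C1 : 0 < `|C'| + 1 by rewrite ltr_wpDl.
near=> H => s sk; set P := \prod_(v <- s) _.
have H1 : `|H| <= 1.
  near: H; apply/nbhs_ballP; exists 1 => //= y.
  by rewrite -ball_normE/= sub0r normrN => /ltW.
have H2 : `|H| <= e / 2 / (`|C'| + 1).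
  near: H; apply/nbhs_ballP; exists (e / 2 / (`|C'| + 1)); first by rewrite /= !divr_gt0.
  by move=> y; rewrite -ball_normE/= sub0r normrN => /ltW.
have Ak : forall l, size l = k -> `|D (x + base H) l - D x l - D x (base H :: l)| <=
    e1 * `|base H| * \prod_(v <- l) `|v| by near: H; exact: Dk.
have Ak1 : forall l, size l = k.+1 -> `|D (x + base H) l - D x l - D x (base H :: l)| <=
    e1 * `|base H| * \prod_(v <- l) `|v| by near: H; exact: Dk1.
have Uh : U (x + base H) by near: H; exact: DU.
set h := base H in Ak Ak1 Uh *; set v := vect H.
have hH : `|h| <= `|H| by exact: base_norm.
have vH : `|v| <= `|H| by exact: vect_norm.
have [_ Dhl _ _] := HD _ Uh.
pose A l := D (x + h) l - D x l - D x (h :: l).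
set sg := map base s; have ssg : size sg = k by rewrite size_map.
have pb : \prod_(v <- sg) `|v| <= P by apply: prod_norm_contract; exact: base_norm.
have pb0 := prod_norm_ge0 sg.
have P0 : 0 <= P by exact: prod_norm_ge0.
have EE : E (Z + H) s - E Z s - E Z (H :: s) = join (A sg)
    (A (sg ++ [:: w]) + (A (sg ++ [:: v]) + D x (h :: sg ++ [:: v])) + leibniz_sum_vect A s).
  rewrite /E -!joinN -!joinD /=; congr join; first by rewrite baseD.
  rewrite /A !leibniz_sum_vectB baseD vectD -/x -/h -/w -/v -/sg.
  have -> : D (x + h) (sg ++ [:: w + v]) = D (x + h) (sg ++ [:: w]) + D (x + h) (sg ++ [:: v]).
    by have := Dhl sg [::] 1 w v; rewrite !scale1r.
  exact: ell2_rearrange.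
rewrite EE (le_trans (join_norm _ _))//.
have n1 : `|A sg| <= e1 * `|H| * P.
  rewrite (le_trans (Ak _ ssg))// ler_pM ?mulr_ge0 ?(ltW e10)//.
  by rewrite ler_wpM2l ?(ltW e10).
have n2 : `|A (sg ++ [:: w])| <= e1 * `|H| * P * `|w|.
  rewrite (le_trans (Ak1 _ _)) ?size_cat ?ssg ?addn1// big_cat big_seq1 mulrA.
  rewrite ler_wpM2r// ler_pM ?mulr_ge0 ?(ltW e10)//.
  by rewrite ler_wpM2l ?(ltW e10).
have n3 : `|A (sg ++ [:: v])| <= e1 * `|H| * P * 1.
  rewrite (le_trans (Ak1 _ _)) ?size_cat ?ssg ?addn1// big_cat big_seq1 mulrA.
  rewrite ler_pM ?mulr_ge0 ?(ltW e10)//; last exact: le_trans H1.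
  by rewrite ler_pM ?mulr_ge0 ?(ltW e10)// ler_wpM2l ?(ltW e10).
(* Both [h] and [v] come from [H], so this term is of second order, and the boundedness of the
   derivative of order [k + 2] controls it. *)
have n4 : `|D x (h :: sg ++ [:: v])| <= e / 2 * `|H| * P.
  rewrite (le_trans (HC' _ _)) /= ?size_cat ?ssg ?addn1// big_cons big_cat big_seq1.
  apply: (@le_trans _ _ (`|C'| * (`|H| * (P * `|H|)))).
    apply: (@le_trans _ _ (`|C'| * (`|h| * (\prod_(v <- sg) `|v| * `|v|)))).
      by rewrite ler_wpM2r ?ler_norm// !mulr_ge0.
    rewrite ler_wpM2l//; apply: ler_pM => //; first by rewrite mulr_ge0.
    exact: ler_pM.
  have -> : `|C'| * (`|H| * (P * `|H|)) = (`|C'| * `|H|) * (`|H| * P) by ring.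
  rewrite -[leRHS]mulrA ler_wpM2r ?mulr_ge0//.
  apply: (@le_trans _ _ (`|H| * (`|C'| + 1))); last by rewrite -ler_pdivlMr.
  by rewrite mulrC ler_wpM2l// lerDl.
have n5 : `|leibniz_sum_vect A s| <= k%:R * (e1 * `|H| * P).
  rewrite -sk; apply: leibniz_sum_vect_norm; first by rewrite mulr_ge0 ?(ltW e10).
  move=> l; rewrite sk => lk; rewrite (le_trans (Ak _ lk))//.
  by rewrite ler_wpM2r ?prod_norm_ge0// ler_wpM2l ?(ltW e10).
have -> : e * `|H| * P = e1 * `|H| * P + (e1 * `|H| * P * `|w| +
    (e1 * `|H| * P * 1 + e / 2 * `|H| * P) + k%:R * (e1 * `|H| * P)).
  transitivity ((e1 * K) * `|H| * P + e / 2 * `|H| * P); last by rewrite /K; ring.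
  by rewrite e1K; field.
rewrite lerD// (le_trans (ler_normD _ _))// lerD//.
rewrite (le_trans (ler_normD _ _))// lerD//.
by rewrite (le_trans (ler_normD _ _))// lerD.
Unshelve. all: by end_near. Qed.

End TangentSmooth.

(** * The total space *)

(** [T] is a bare type, so that the metric packed here does not meet the product structure that
    [M * X] carries. Both maps are the identity. *)
Lemma metrize (R : realType) (T : Type) (dist : T -> T -> R) :
  (forall x, dist x x = 0) -> (forall x y, dist x y = 0 -> x = y) ->
  (forall x y, dist x y = dist y x) ->
  (forall y x z, dist x z <= dist x y + dist y z) ->
  exists (TM : metricType R) (to : T -> TM) (of_ : TM -> T),
    [/\ cancel to of_, cancel of_ to & forall p q, mdist p q = dist (of_ p) (of_ q)].
Proof.
move=> dxx dpos dsym dtri.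
pose eqm := gen_eqMixin T; pose chm := gen_choiceMixin T.
pose TC : choiceType := HB.pack T eqm chm.
pose mm := isMetric.Build R TC dxx dpos dsym dtri.
pose TM : metricType R := HB.pack T eqm chm mm.
by exists TM, (fun x : T => x : TM), (fun x : TM => x : T).
Qed.

(** The distance to the complement truncated at [1], written as a supremum of radii of balls inside
    [U]; this form also makes sense when the complement is empty. Moving the centre shrinks such a
    ball by at most the displacement, whence the Lipschitz bound. *)
Lemma bump_exists (R : realType) (M : metricType R) (U : set M) : open U ->
  exists lam : M -> R, [/\ forall x, 0 <= lam x <= 1, forall x, U x -> 0 < lam x,
    forall x, ~ U x -> lam x = 0 & forall x y, `|lam x - lam y| <= mdist x y].
Proof.
move=> oU.
pose S x : set R := [set r | 0 <= r <= 1 /\ forall y, mdist x y < r -> U y].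
have S0 x : S x 0.
  by split; rewrite ?lexx ?ler01// => y; rewrite ltNge mdist_ge0.
have Sub x : has_sup (S x).
  by split; [exists 0|exists 1 => r [/andP[]]].
have le_lam x r : S x r -> r <= sup (S x) by exact: sup_upper_bound (Sub x) _.
have lam_le x r : (forall t, S x t -> t <= r) -> sup (S x) <= r.
  by move=> H; apply: ge_sup => //; exists 0.
exists (fun x => sup (S x)); split.
- move=> x; rewrite le_lam//=; apply: lam_le => r [/andP[]]//.
- move=> x Ux; have /nbhs_ballP[r /= r0 rU] : nbhs x U by exact: open_nbhs_nbhs.
  apply: (@lt_le_trans _ _ (Num.min r 1)); first by rewrite lt_min r0 ltr01.
  apply: le_lam; split; first by rewrite le_min ler01 (ltW r0) ge_min lexx orbT.
  by move=> y; rewrite lt_min => /andP[xy _]; apply: rU; rewrite ballEmdist.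
- move=> x nUx; apply/eqP; rewrite eq_le le_lam// andbT; apply: lam_le => r [_ rU].
  by rewrite leNgt; apply/negP => r0; apply/nUx/rU; rewrite mdistxx.
have H x y : sup (S x) <= sup (S y) + mdist x y.
  apply: lam_le => r [/andP[r0 r1] rU]; rewrite -lerBlDr.
  have [rd|dr] := leP (r - mdist x y) 0; first exact: le_trans rd (le_lam _ _ (S0 _)).
  apply: le_lam; split.
    by rewrite (ltW dr) (le_trans _ r1)// gerBl mdist_ge0.
  move=> z yz; apply: rU; rewrite (le_lt_trans (metric_triangle _ y _))//.
  by rewrite addrC -ltrBrDr.
move=> x y; rewrite ler_norml; have := H x y; have := H y x; rewrite metric_sym.
by move: (sup _) (sup _) (mdist _ _) => a b m; lra.
Qed.

Lemma normed_connected (R : realType) (V : normedModType R) : connected [set: V].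
Proof.
have -> : [set: V] = \bigcup_(v in [set: V]) ((fun t : R => t *: v) @` `[0, 1]).
  apply/seteqP; split => // v _; exists v => //.
  by exists 1; rewrite ?scale1r//= in_itv/= ler01 lexx.
apply: bigcup_connected.
  by exists 0 => v _; exists 0; rewrite ?scale0r//= in_itv/= ler01 lexx.
move=> v _; apply: connected_continuous_connected; first exact: segment_connected.
by apply: continuous_subspaceT => t; apply: cvgZr_tmp; exact: cvg_id.
Qed.

Lemma nonexpansive_continuous (R : realType) (V W : normedModType R) (f : V -> W) :
  (forall x y, `|f x - f y| <= `|x - y|) -> continuous f.
Proof.
move=> Hf x; apply/cvgrPdist_le => e e0.
have /cvgrPdist_le/(_ e e0) : id @ x --> x by exact: cvg_id.
by apply: filterS => y; apply: le_trans.
Qed.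

(** * Images of tangent charts are smooth domains *)

Section TangentDomain.
Variables (R : realType) (d : model).
Local Notation X := (qspace R d).
Local Notation X2 := (qspace R (tangent_model d)).
Local Notation base := (@base_part R d).

Lemma base_continuous : continuous base.
Proof. by apply: nonexpansive_continuous => x y; rewrite -baseB base_norm. Qed.

Lemma vect_continuous : continuous (@vect_part R d).
Proof. by apply: nonexpansive_continuous => x y; rewrite -vectB vect_norm. Qed.

(** The set is a union of connected crosses, each made of the zero section over [O] and of one
    fibre; they all share the point [join y0 0]. *)
Lemma base_preimage_connected (O : set X) : connected O -> O !=set0 ->
  connected (base @^-1` O).
Proof.
move=> cO [y0 Oy0].
pose C (y : X) : set X2 := ((fun x => join x 0) @` O) `|` ((fun v => join y v) @` [set: X]).
have -> : base @^-1` O = \bigcup_(y in O) C y.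
  apply/seteqP; split => [Z /= OZ|Z [y Oy [[x Ox <-]|[v _ <-]]]].
  - by exists (base Z) => //; right; exists (vect_part Z) => //; rewrite join_parts.
  - by rewrite /= base_join.
  - by rewrite /= base_join.
have cj (a b : X -> X) : continuous a -> continuous b -> continuous (fun v => join (a v) (b v)).
  by move=> ca cb v; exact: (@join_cvg _ _ _ (nbhs v) _ a b _ _ (ca v) (cb v)).
apply: bigcup_connected; first by exists (join y0 0) => y Oy; left; exists y0.
move=> y Oy; apply: connectedU.
- by exists (join y 0); split; [exists y|exists 0].
- apply: connected_continuous_connected => //; apply: continuous_subspaceT.
  by apply: (cj idfun (cst 0)) => [v|]; [exact: cvg_id|exact: cst_continuous].
- apply: connected_continuous_connected; first exact: normed_connected.
  apply: continuous_subspaceT.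
  by apply: (cj (cst y) idfun) => [|v]; [exact: cst_continuous|exact: cvg_id].
Qed.

(** Boundary points lie over boundary points of [O], and the local equation pulls back along [base];
    a direction [h] transversal to the hypersurface lifts to [join h 0]. *)
Lemma base_smooth_domain (O : set X) : smooth_domain O -> smooth_domain (base @^-1` O).
Proof.
move=> [[y0 Oy0] oO cO bO]; split.
- by exists (join y0 0); rewrite /= base_join.
- by apply: open_comp => // z _; exact: base_continuous.
- by apply: base_preimage_connected => //; exists y0.
move=> p pO nOp.
have cp : closure O (base p).
  move=> B Bp; have [q [Oq Bq]] := pO _ (base_continuous Bp).
  by exists (base q).
have [W [rho [oW Wp [D HD] [h dh] OW]]] := bO _ cp nOp.
have bP : forall (a : R) u v, base (a *: u + v) = a *: base u + base v by exact: baseP.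
have sW : frechet_smooth (base @^-1` W) (rho \o base).
  by apply: frechet_smooth_contract => //; [exact: base_norm|exists D].
have oW' : open (base @^-1` W) by apply: open_comp => // z _; exact: base_continuous.
exists (base @^-1` W), (rho \o base); split => //.
  exists (join h 0); have f1 := smooth_fder oW HD Wp.
  have fb : is_fder base p base.
    split => // [|e e0]; first by exists 1 => v; rewrite mul1r base_norm.
    by near=> k; rewrite baseD addrAC addrK subrr normr0 mulr_ge0// ltW.
  have [_ E1] := is_fder_diff f1; have [_ ->] := is_fder_diff (is_fder_comp fb f1).
  by move: dh; rewrite E1 /= base_join.
apply/seteqP; split => [z [Oz Wz]|z [Wz rz]] /=.
  by have : (O `&` W) (base z) by []; rewrite OW => -[].
by have : (O `&` W) (base z) by rewrite OW.
Unshelve. all: by end_near. Qed.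

End TangentDomain.

(** * The fibre as a left and right module over the quaternions *)

Section Bimodule.
Variables (R : realType) (d : model).

Lemma lmul_summable (a : quat R) (x : qspace R d) : (ell2_sum (fun i => a * x i)%R < +oo)%E.
Proof.
apply: (@le_lt_trans _ _ ((`|a| ^+ 2)%:E * ell2_sum x)%E).
  rewrite /ell2_sum; under eq_esum do rewrite qnormM exprMn.
  by apply: esumZ; rewrite ?sqr_ge0// => i; rewrite sqr_ge0.
by rewrite ell2_sumE -EFinM ltry.
Qed.

Lemma rmul_summable (x : qspace R d) (a : quat R) : (ell2_sum (fun i => x i * a)%R < +oo)%E.
Proof.
apply: le_lt_trans (lmul_summable a x); rewrite /ell2_sum.
by under eq_esum do rewrite qnormM mulrC -qnormM.
Qed.

(* An alias, since [qspace R d] already carries its structure of real vector space. *)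
Definition qvect := qspace R d.
HB.instance Definition _ := GRing.Zmodule.on qvect.

Definition lscale (a : quat R) (x : qvect) : qvect := Ell2 (lmul_summable a x).
Definition rightscale (x : qvect) (a : quat R) : qvect := Ell2 (rmul_summable x a).

Lemma lscaleA a b v : lscale a (lscale b v) = lscale (a * b) v.
Proof. by apply: ell2P => i /=; rewrite mulrA. Qed.
Lemma lscale1 : left_id 1 lscale.
Proof. by move=> v; apply: ell2P => i /=; rewrite mul1r. Qed.
Lemma lscaleDr : right_distributive lscale +%R.
Proof. by move=> a u v; apply: ell2P => i /=; rewrite mulrDr. Qed.
Lemma lscaleDl v : {morph lscale^~ v : a b / a + b}.
Proof. by move=> a b; apply: ell2P => i /=; rewrite mulrDl. Qed.
HB.instance Definition _ := GRing.Zmodule_isLmodule.Build (quat R) qvect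
  lscaleA lscale1 lscaleDr lscaleDl.

Lemma rightscaleA v a b : rightscale (rightscale v a) b = rightscale v (a * b).
Proof. by apply: ell2P => i /=; rewrite mulrA. Qed.
Lemma rightscale1 v : rightscale v 1 = v.
Proof. by apply: ell2P => i /=; rewrite mulr1. Qed.
Lemma rightscaleDl u v a : rightscale (u + v) a = rightscale u a + rightscale v a.
Proof. by apply: ell2P => i /=; rewrite mulrDl. Qed.
Lemma rightscaleDr v a b : rightscale v (a + b) = rightscale v a + rightscale v b.
Proof. by apply: ell2P => i /=; rewrite mulrDr. Qed.
Lemma lscale_rightscale (a : quat R) v b : a *: rightscale v b = rightscale (a *: v) b.
Proof. by apply: ell2P => i /=; rewrite mulrA. Qed.
HB.instance Definition _ := Lmodule_isBimodule.Build (quat R) qvect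
  rightscaleA rightscale1 rightscaleDl rightscaleDr lscale_rightscale.

End Bimodule.

Lemma is_fder_id (R : realType) (V : normedModType R) (x : V) : is_fder idfun x idfun.
Proof.
split; [by []|by exists 1 => v; rewrite mul1r|].
move=> e e0; near=> h; rewrite addrAC addrK subrr normr0 mulr_ge0//; exact: ltW.
Unshelve. all: by end_near. Qed.

Lemma cvg0_dominated (R : realType) (V : normedModType R) (T : Type)
    (F : set_system T) (FF : Filter F) (f : T -> V) (g : T -> R) :
  (forall t, `|f t| <= g t) -> g @ F --> 0 -> f @ F --> 0.
Proof.
move=> fg g0; apply/cvgr0Pnorm_le => e e0.
move/cvgr0Pnorm_le: g0 => /(_ e e0); apply: filterS => t.
by apply: le_trans; rewrite (le_trans (fg t))// ler_norm.
Qed.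

Section Squash.
Variables (R : realType) (V : normedModType R).
Implicit Types v : V.

(** A homeomorphism onto the open unit ball with inverse [unsquash]: it makes the supremum in [gap]
    finite and still allows the fibre coordinate to be recovered. *)
Definition squash (v : V) : V := (1 + `|v|)^-1 *: v.
Definition unsquash (v : V) : V := (1 - `|v|)^-1 *: v.

Lemma squash_norm v : `|squash v| < 1.
Proof.
have v1 : 0 < 1 + `|v| by rewrite ltr_pwDl.
rewrite normrZ gtr0_norm ?invr_gt0// mulrC ltr_pdivrMr// mul1r ltrDr//.
Qed.

Lemma squashK : cancel squash unsquash.
Proof.
move=> v; have v1 : 0 < 1 + `|v| by rewrite ltr_pwDl.
rewrite /unsquash /squash normrZ gtr0_norm ?invr_gt0// scalerA.
rewrite [X in X *: _](_ : _ = 1) ?scale1r//.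
move: `|v| v1 => t t1; have t0 : 1 + t != 0 by rewrite gt_eqF.
rewrite -invfM (_ : _ * _ = 1) ?invr1//.
by field.
Qed.

Lemma squash_continuous : continuous squash.
Proof.
move=> v; rewrite /continuous_at /squash; apply: cvgZ; last exact: cvg_id.
apply: cvgV; first by rewrite gt_eqF// ltr_pwDl.
by apply: cvgD; [exact: cvg_cst|apply: cvg_norm; exact: cvg_id].
Qed.

Lemma unsquash_cvg v : `|v| < 1 -> unsquash @ v --> unsquash v.
Proof.
move=> v1; rewrite /unsquash; apply: cvgZ; last exact: cvg_id.
apply: cvgV; first by rewrite gt_eqF// subr_gt0.
by apply: cvgB; [exact: cvg_cst|apply: cvg_norm; exact: cvg_id].
Qed.

End Squash.

Lemma near_mdist (R : realType) (T : metricType R) (p : T) (e : R) : 0 < e ->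
  \forall q \near p, mdist p q < e.
Proof.
by move=> e0; apply/nbhs_ballP; exists e => // q; rewrite ballEmdist.
Qed.

Lemma near_mdistP (R : realType) (T : metricType R) (p : T) (P : set T) :
  (\forall q \near p, P q) ->
  exists2 e : R, 0 < e & forall q, mdist p q < e -> P q.
Proof.
by move=> /nbhs_ballP[e /= e0 eP]; exists e => // q pq; apply: eP; rewrite ballEmdist.
Qed.

(** * The transition cocycle, tangent coordinates and the distance *)

Section Atlas.
Variables (R : realType) (d : model) (M : metricType R) (J : countType).
Variable c : J -> qchart R M d.
Hypothesis Hc : quaternion_manifold c.
Local Notation X := (qspace R d).
Local Notation X2 := (qspace R (tangent_model d)).
Local Notation U j := (chart_dom (c j)).
Local Notation phi j := (chart_map (c j)).
Local Notation inv j := (chart_inv (c j)).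
Local Notation tr j m := (transition (c j) (c m)).
Local Notation ov j m := (overlap (c j) (c m)).
Local Notation base := (@base_part R d).
Local Notation vect := (@vect_part R d).

Lemma chart_open j : open (U j).
Proof. by have [_ _ Hj _] := Hc; case: (Hj j). Qed.

Lemma chart_img_open j : open (chart_img (c j)).
Proof. by have [_ _ Hj _] := Hc; have [_ [_ ? _ _] _ _ _] := Hj j. Qed.

Lemma chart_mapK j x : U j x -> inv j (phi j x) = x.
Proof. by have [_ _ Hj _] := Hc; have [_ _ K _ _] := Hj j => Ux; apply: K; exact/mem_set. Qed.

Lemma chart_invP j y : chart_img (c j) y -> U j (inv j y) /\ phi j (inv j y) = y.
Proof. by move=> [x Ux <-]; rewrite chart_mapK. Qed.

Lemma chart_map_cvg j x : U j x -> phi j @ x --> phi j x.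
Proof.
have [_ _ Hj _] := Hc; have [oU _ _ cphi _] := Hj j => Ux.
by move: cphi; rewrite continuous_open_subspace// => /(_ x); apply; exact/mem_set.
Qed.

Lemma chart_inv_cvg j y : chart_img (c j) y -> inv j @ y --> inv j y.
Proof.
have [_ _ Hj _] := Hc; have [_ _ _ _ cinv] := Hj j => Oy.
have oO := @chart_img_open j.
by move: cinv; rewrite continuous_open_subspace// => /(_ y); apply; exact/mem_set.
Qed.

Lemma overlapP j m y : ov j m y <-> chart_img (c j) y /\ U m (inv j y).
Proof.
split=> [[x [Ujx Umx] <-]|[Oy Umy]].
  by split; [exists x|rewrite chart_mapK].
by have [Uy yE] := chart_invP Oy; exists (inv j y).
Qed.

Lemma overlap_open j m : open (ov j m).
Proof.
rewrite openE => y /overlapP[Oy Umy]; rewrite /interior.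
have n1 : nbhs y (chart_img (c j)) by apply: open_nbhs_nbhs; split => //; exact: chart_img_open.
have n2 : nbhs y (inv j @^-1` U m).
  by apply: (chart_inv_cvg Oy); apply: open_nbhs_nbhs; split => //; exact: chart_open.
by apply: filterS (filterI n1 n2) => z [? ?]; apply/overlapP.
Qed.

Lemma transition_holomorphic j m : qholomorphic (ov j m) (tr j m).
Proof. by have [_ _ _ Hjm] := Hc; have [_ _ [? _] _] := Hjm j m. Qed.

Lemma transition_smooth j m : d = l2H -> frechet_smooth (ov j m) (tr j m).
Proof. by have [_ _ _ Hjm] := Hc; have [_ _ [_ +] _] := Hjm j m. Qed.

Definition transition_der j m x : X -> X := 'd (tr j m) (phi j x).

Lemma transition_fder j m x : U j x -> U m x ->
  is_fder (tr j m) (phi j x) (transition_der j m x).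
Proof.
move=> Ujx Umx; apply: (qholomorphic_fder (@transition_holomorphic j m)).
by exists x.
Qed.

Lemma transition_derP j m x : U j x -> U m x -> forall (a : R) u v,
  transition_der j m x (a *: u + v) = a *: transition_der j m x u + transition_der j m x v.
Proof. by move=> Ujx Umx; have [] := transition_fder Ujx Umx. Qed.

Lemma transitionE j m x : U j x -> tr j m (phi j x) = phi m x.
Proof. by move=> Ux; rewrite /transition /= chart_mapK. Qed.

(** Chain rule: near [phi j x] the transition maps compose, and a derivative depends only on the
    germ. *)
Lemma transition_der_comp j m l x v : U j x -> U m x -> U l x ->
  transition_der m l x (transition_der j m x v) = transition_der j l x v.
Proof.
move=> Ujx Umx Ulx.
have f1 := transition_fder Ujx Umx; have f2 := transition_fder Umx Ulx.
rewrite -(transitionE m Ujx) in f2; have f12 := is_fder_comp f1 f2.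
have near_eq : \forall y \near phi j x, (tr m l \o tr j m) y = tr j l y.
  have : nbhs (phi j x) (ov j m) by apply: open_nbhs_nbhs; split; [exact: overlap_open|exists x].
  by apply: filterS => y [z [Ujz Umz] <-]; rewrite /= !transitionE.
have [_ E] := is_fder_diff (near_is_fder near_eq f12).
by rewrite {3}/transition_der E.
Qed.

Lemma transition_der_id j x v : U j x -> transition_der j j x v = v.
Proof.
move=> Ux; have near_eq : \forall y \near phi j x, tr j j y = idfun y.
  have : nbhs (phi j x) (ov j j) by apply: open_nbhs_nbhs; split; [exact: overlap_open|exists x].
  by apply: filterS => y [z [Uz _] <-]; rewrite transitionE.
have [_ dtr] := is_fder_diff (near_is_fder near_eq (transition_fder Ux Ux)).
have fid := @is_fder_id _ X (phi j x).
by have [_ did] := is_fder_diff fid; rewrite -dtr did.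
Qed.

Lemma charts_cover x : exists j, U j x.
Proof.
have [_ cov _ _] := Hc; have : [set: M] x by [].
by rewrite -cov => -[j _ Ux]; exists j.
Qed.

Definition home x : J := projT1 (cid (charts_cover x)).
Lemma homeP x : U (home x) x. Proof. exact: (projT2 (cid (charts_cover x))). Qed.

(* A point of the total space is a pair [(x, v)], with the vector [v] at [x] read
   in the chart [home x]. *)
Definition fib j (p : M * X) : X := transition_der (home p.1) j p.1 p.2.
Definition tmap j (p : M * X) : X2 := join (phi j p.1) (fib j p).
Definition tinv j (Z : X2) : M * X :=
  (inv j (base Z), transition_der j (home (inv j (base Z))) (inv j (base Z)) (vect Z)).

Lemma fib_home p : fib (home p.1) p = p.2.
Proof. exact: (transition_der_id _ (homeP _)). Qed.

Lemma tmapK j p : U j p.1 -> tinv j (tmap j p) = p.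
Proof.
case: p => x v /= Ux; rewrite /tinv /tmap base_join vect_join /= chart_mapK//.
rewrite /fib /= transition_der_comp//; try exact: homeP.
by rewrite transition_der_id//; exact: homeP.
Qed.

Lemma tinv_dom j Z : chart_img (c j) (base Z) -> U j (tinv j Z).1.
Proof. by move=> /chart_invP[]. Qed.

Lemma fib_tinv j m Z : chart_img (c j) (base Z) -> U m (tinv j Z).1 ->
  fib m (tinv j Z) = transition_der j m (tinv j Z).1 (vect Z).
Proof.
move=> /chart_invP[Uj _] Um; rewrite /fib /= transition_der_comp//; exact: homeP.
Qed.

Lemma tmap_tinv j m Z : ov j m (base Z) ->
  tmap m (tinv j Z) = tangent_map (tr j m) Z.
Proof.
move=> /overlapP[Oj Um]; have [Uj E] := chart_invP Oj.
rewrite /tmap fib_tinv// /tangent_map /transition_der -{1}E transitionE//=.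
by rewrite E.
Qed.

Lemma tinvK j Z : chart_img (c j) (base Z) -> tmap j (tinv j Z) = Z.
Proof.
move=> Oj; have [Uj E] := chart_invP Oj.
rewrite /tmap fib_tinv// transition_der_id//= E; exact: join_parts.
Qed.

Definition lam j : M -> R := projT1 (cid (bump_exists (chart_open j))).
Lemma lamP j : [/\ forall x, 0 <= lam j x <= 1, forall x, U j x -> 0 < lam j x,
  forall x, ~ U j x -> lam j x = 0 & forall x y, `|lam j x - lam j y| <= mdist x y].
Proof. exact: (projT2 (cid (bump_exists (chart_open j)))). Qed.

(* The factor [lam j] makes [psi j] continuous across the boundary of [U j],
   where the fibre coordinate itself may blow up. *)
Definition psi j p : X := lam j p.1 *: squash (fib j p).

Lemma psi_norm j p : `|psi j p| <= lam j p.1.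
Proof.
have [l01 _ _ _] := lamP j; have /andP[l0 _] := l01 p.1.
by rewrite normrZ ger0_norm// ler_piMr// ltW// squash_norm.
Qed.

Lemma psi_diff j p q : `|psi j p - psi j q| <= 2.
Proof.
have [l01 _ _ _] := lamP j; have /andP[_ lp] := l01 p.1; have /andP[_ lq] := l01 q.1.
rewrite (le_trans (ler_normB _ _))//.
have := psi_norm j p; have := psi_norm j q; lra.
Qed.

(** As [psi j p - psi j q] has norm at most [2], these weights make all but finitely many charts
    negligible, uniformly in the points. *)
Definition weight_of (j : J) : R := 2^-1 ^+ choice.pickle j.
Lemma weight_of_gt0 j : 0 < weight_of j.
Proof. by rewrite exprn_gt0. Qed.
Lemma weight_of_le1 j : weight_of j <= 1.
Proof. by rewrite exprn_ile1// invf_le1// ler1n. Qed.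

(** The element [0] keeps the set nonempty when there is no chart. *)
Definition gap_set p q : set R :=
  [set r | r = 0 \/ exists j, r = weight_of j * `|psi j p - psi j q|].
Definition gap p q := sup (gap_set p q).

Lemma gap_has_sup p q : has_sup (gap_set p q).
Proof.
split; first by exists 0; left.
exists 2 => _ [->//|[j ->]].
by rewrite -[leRHS]mul1r ler_pM ?(ltW (weight_of_gt0 _))// ?weight_of_le1// psi_diff.
Qed.

Lemma gap_ge0 p q : 0 <= gap p q.
Proof. by apply: sup_upper_bound (gap_has_sup p q) _ _; left. Qed.

Lemma gap_ge j p q : weight_of j * `|psi j p - psi j q| <= gap p q.
Proof. by apply: sup_upper_bound (gap_has_sup p q) _ _; right; exists j. Qed.

Lemma gap_le p q r : 0 <= r ->
  (forall j, weight_of j * `|psi j p - psi j q| <= r) -> gap p q <= r.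
Proof.
by move=> r0 H; apply: ge_sup => [|_ [->//|[j ->]]]; [exists 0; left|exact: H].
Qed.

Definition tdist (p q : M * X) : R := mdist p.1 q.1 + gap p q.

Lemma tdist_xx p : tdist p p = 0.
Proof.
rewrite /tdist mdistxx add0r; apply/eqP; rewrite eq_le gap_ge0 andbT.
by apply: gap_le => // j; rewrite subrr normr0 mulr0.
Qed.

(** Once the base points agree, the chart [home x] alone separates the vectors: [lam] is positive
    there and [squash] is injective. *)
Lemma tdist_pos p q : tdist p q = 0 -> p = q.
Proof.
case: p q => [x v] [y w] /eqP.
rewrite /tdist paddr_eq0 ?gap_ge0 ?mdist_ge0//= => /andP[/eqP/mdist_positivity xy /eqP g0].
rewrite -xy in g0 *; congr pair.
have [_ lpos _ _] := lamP (home x).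
have := gap_ge (home x) (x, v) (x, w); rewrite g0 pmulr_rle0 ?weight_of_gt0//.
rewrite normr_le0 subr_eq0 /psi (fib_home (x, v)) (fib_home (x, w)) /= => /eqP.
move=> /(scalerI (lt0r_neq0 (lpos _ (homeP x)))).
by move=> /(can_inj (@squashK _ _)).
Qed.

Lemma tdist_sym p q : tdist p q = tdist q p.
Proof.
rewrite /tdist metric_sym; congr +%R; rewrite /gap; congr sup.
by apply/seteqP; split=> r [->|[j ->]]; by [left|right; exists j; rewrite distrC].
Qed.

Lemma tdist_triangle q p r : tdist p r <= tdist p q + tdist q r.
Proof.
rewrite /tdist addrACA lerD ?metric_triangle//.
apply: gap_le => [|j]; first by rewrite addr_ge0 ?gap_ge0.
rewrite (le_trans _ (lerD (gap_ge j p q) (gap_ge j q r)))//.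
by rewrite -mulrDr ler_wpM2l ?(ltW (weight_of_gt0 _))// ler_distD.
Qed.

Lemma lam_continuous j : continuous (lam j).
Proof.
move=> x; apply/cvgrPdist_lt => e e0; apply: filterS (near_mdist x e0) => y.
by have [_ _ _ H] := lamP j; apply: le_lt_trans.
Qed.

(** * Topology and atlas of the total space *)

Section TotalSpace.
Variables (TM : metricType R) (to : M * X -> TM) (of_ : TM -> M * X).
Hypotheses (toK : cancel to of_) (ofK : cancel of_ to).
Hypothesis distE : forall p q, mdist p q = tdist (of_ p) (of_ q).

Definition proj (p : TM) : M := (of_ p).1.

Definition tchart j : qchart R TM (tangent_model d) :=
  QChart (proj @^-1` U j) (fun p => tmap j (of_ p)) (fun Z => to (tinv j Z)).

Lemma proj_continuous : continuous proj.
Proof.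
move=> p A /near_mdistP[e e0 eA]; apply: filterS (near_mdist p e0) => q.
rewrite distE => pq; apply: eA; apply: le_lt_trans pq.
by rewrite lerDl gap_ge0.
Qed.

Lemma psi_continuous j : continuous (fun p => psi j (of_ p)).
Proof.
move=> p; apply/cvgrPdist_lt => e e0.
have we0 : 0 < weight_of j * e by rewrite mulr_gt0 ?weight_of_gt0.
apply: filterS (near_mdist p we0) => q; rewrite distE => pq.
rewrite -(ltr_pM2l (weight_of_gt0 j)); apply: le_lt_trans pq.
by rewrite (le_trans (gap_ge j _ _))// lerDr mdist_ge0.
Qed.

Lemma tchart_dom_open j : open (chart_dom (tchart j)).
Proof. by apply: open_comp (chart_open j) => p _; exact: proj_continuous. Qed.

(** Over [U j] the factor [lam j] is positive, so [fib j] is recovered continuously from [psi j] by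
    dividing and unsquashing. *)
Lemma fib_cvg j p : U j (proj p) ->
  (fun q => fib j (of_ q)) @ p --> fib j (of_ p).
Proof.
move=> Up; have [_ lpos _ _] := lamP j.
have fE q : U j (proj q) ->
    fib j (of_ q) = unsquash ((lam j (proj q))^-1 *: psi j (of_ q)).
  move=> Uq; rewrite /psi scalerA mulVf ?scale1r ?squashK//.
  by rewrite gt_eqF// lpos.
have Unear : \forall q \near p, U j (proj q).
  by have := tchart_dom_open j; rewrite openE => /(_ p Up).
have cq : (fun q => unsquash ((lam j (proj q))^-1 *: psi j (of_ q))) @ p -->
    unsquash ((lam j (proj p))^-1 *: psi j (of_ p)).
  have cin : (fun q => (lam j (proj q))^-1 *: psi j (of_ q)) @ p -->
      (lam j (proj p))^-1 *: psi j (of_ p).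
    apply: cvgZ; last exact: psi_continuous.
    apply: cvgV; first by rewrite gt_eqF// lpos.
    exact: (cvg_comp _ _ (@proj_continuous p) (@lam_continuous j (proj p))).
  apply: (cvg_comp _ _ cin); apply: unsquash_cvg.
  rewrite /psi scalerA mulVf ?scale1r ?squash_norm//.
  by rewrite gt_eqF// lpos.
have En : {near p, (fun q => unsquash ((lam j (proj q))^-1 *: psi j (of_ q))) =1
    (fun q => fib j (of_ q))} by apply: filterS Unear => q Uq; rewrite fE.
by rewrite (fE p Up); exact: cvg_trans (near_eq_cvg En) cq.
Qed.

Lemma tchart_cvg j p : U j (proj p) ->
  (fun q => tmap j (of_ q)) @ p --> tmap j (of_ p).
Proof.
move=> Up; apply: (@join_cvg _ _ _ (nbhs p) _ (fun q => phi j (proj q)) (fun q => fib j (of_ q))).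
  exact: (cvg_comp _ _ (@proj_continuous p) (chart_map_cvg Up)).
exact: fib_cvg.
Qed.

(** Joint continuity in the point and the vector comes from the analyticity of the tangent map
    itself. *)
Lemma tangent_map_cvg j m Z : ov j m (base Z) ->
  tangent_map (tr j m) @ Z --> tangent_map (tr j m) Z.
Proof.
move=> oZ; have hT := tangent_map_holomorphic (@overlap_open j m) (@transition_holomorphic j m).
have [r [P [b psf]]] := hT Z oZ.
by have [dT _] := is_fder_diff (power_series_fder psf); exact: differentiable_continuous.
Qed.

Lemma base_inv_cvg j Z : chart_img (c j) (base Z) ->
  (fun Z' => inv j (base Z')) @ Z --> inv j (base Z).
Proof.
by move=> OZ; exact: (cvg_comp _ _ (@base_continuous R d Z) (chart_inv_cvg OZ)).
Qed.

(** Over [U m] this is the continuity of the tangent map. Elsewhere the value is [0], and [psi m] is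
    dominated by [lam m], which tends to [0] there whatever the fibre coordinate does. *)
Lemma psi_tinv_cvg j m Z : chart_img (c j) (base Z) ->
  (fun Z' => psi m (tinv j Z')) @ Z --> psi m (tinv j Z).
Proof.
move=> OZ; have [l01 lpos l0 _] := lamP m.
have lcvg : (fun Z' => lam m (inv j (base Z'))) @ Z --> lam m (inv j (base Z)).
  exact: (cvg_comp _ _ (base_inv_cvg OZ) (@lam_continuous m _)).
have [Um|nUm] := pselect (U m (inv j (base Z))).
  have oZ : ov j m (base Z) by apply/overlapP.
  have fE Z' : ov j m (base Z') -> fib m (tinv j Z') = vect (tangent_map (tr j m) Z').
    by move=> oZ'; rewrite -tmap_tinv// vect_join.
  have c1 : (fun Z' => lam m (inv j (base Z')) *: squash (vect (tangent_map (tr j m) Z')))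
      @ Z --> lam m (inv j (base Z)) *: squash (vect (tangent_map (tr j m) Z)).
    have cV := cvg_comp _ _ (tangent_map_cvg oZ) (@vect_continuous R d (tangent_map (tr j m) Z)).
    have cS := cvg_comp _ _ cV (@squash_continuous _ _ (vect (tangent_map (tr j m) Z))).
    exact: (cvgZ lcvg cS).
  have En : {near Z, (fun Z' => lam m (inv j (base Z')) *:
      squash (vect (tangent_map (tr j m) Z'))) =1 (fun Z' => psi m (tinv j Z'))}.
    have : nbhs Z (base @^-1` ov j m).
      apply: open_nbhs_nbhs; split => //; apply: open_comp (@overlap_open j m) => z _.
      exact: base_continuous.
    by apply: filterS => Z' oZ'; rewrite /psi fE.
  by rewrite {2}/psi fE//; exact: cvg_trans (near_eq_cvg En) c1.
have -> : psi m (tinv j Z) = 0 by rewrite /psi /= (l0 _ nUm) scale0r.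
rewrite l0// in lcvg.
exact: (@cvg0_dominated _ _ _ (nbhs Z) _ (fun Z' => psi m (tinv j Z'))
  (fun Z' => lam m (inv j (base Z'))) (fun Z' => psi_norm m (tinv j Z')) lcvg).
Qed.

(** The charts with code below [N] are handled by continuity, all the others at once by their
    weight. *)
Lemma tinv_cvg j Z : chart_img (c j) (base Z) ->
  (fun Z' => to (tinv j Z')) @ Z --> to (tinv j Z).
Proof.
move=> OZ; suff H e : 0 < e -> \forall Z' \near Z, tdist (tinv j Z) (tinv j Z') <= e.
  move=> A /near_mdistP[e e0 eA]; have e2 : 0 < e / 2 by rewrite divr_gt0.
  apply: filterS (H _ e2) => Z' ZZ'; apply: eA; rewrite distE !toK.
  by rewrite (le_lt_trans ZZ')// ltr_pdivrMr// ltr_pMr// ltr1n.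
move=> e0; pose d2 := e / 2; have d20 : 0 < d2 by rewrite divr_gt0.
have n1 : \forall Z' \near Z, mdist (inv j (base Z)) (inv j (base Z')) < d2.
  exact: (base_inv_cvg OZ (near_mdist (inv j (base Z)) d20)).
have [N HN] : exists N, 2 * 2^-1 ^+ N <= d2.
  have : (fun N => 2 * 2^-1 ^+ N) @ \oo --> (0 : R).
    rewrite -(mulr0 2); apply: cvgM; first exact: cvg_cst.
    by apply: cvg_expr; rewrite gtr0_norm ?invr_gt0// invf_lt1// ltr1n.
  move=> /cvgr0Pnorm_le/(_ _ d20)[N _ /(_ N (leqnn N)) HN]; exists N.
  by apply: le_trans HN; exact: ler_norm.
(* A chart is determined by its code, so each step of the induction adds at most one continuity
   condition. *)
have n2 : forall K, \forall Z' \near Z, forall m, (choice.pickle m < K)%N ->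
    `|psi m (tinv j Z) - psi m (tinv j Z')| <= d2.
  elim=> [|K IH]; first by near=> Z' => m; rewrite ltn0.
  have [[m0 m0K]|nK] := pselect (exists m0 : J, choice.pickle m0 = K).
    have cm : \forall Z' \near Z, `|psi m0 (tinv j Z) - psi m0 (tinv j Z')| <= d2.
      have := @cvgr_dist_le _ _ _ (nbhs Z) _ _ _ (psi_tinv_cvg (m := m0) OZ) _ d20.
      exact.
    apply: filterS (filterI IH cm) => Z' [IHZ H0] m; rewrite ltnS leq_eqVlt.
    move=> /orP[/eqP mK|]; last exact: IHZ.
    have -> // : m = m0 by apply: (pcan_inj choice.pickleK); rewrite mK m0K.
  apply: filterS IH => Z' IHZ m; rewrite ltnS leq_eqVlt => /orP[/eqP mK|]; last exact: IHZ.
  by exfalso; apply: nK; exists m.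
apply: filterS (filterI n1 (n2 N)) => Z' [H1 H2].
rewrite /tdist [leRHS]splitr lerD//; first exact: ltW.
apply: gap_le => [|m]; first exact: ltW.
have [mN|Nm] := ltnP (choice.pickle m) N.
  by rewrite -[leRHS]mul1r ler_pM ?(ltW (weight_of_gt0 _))// ?weight_of_le1// H2.
apply: le_trans HN; rewrite mulrC ler_pM ?psi_diff ?(ltW (weight_of_gt0 _))//.
by apply: ler_wiXn2l => //; rewrite invf_le1// ler1n.
Unshelve. all: by end_near. Qed.

Lemma tchart_img j : chart_img (tchart j) = base @^-1` chart_img (c j).
Proof.
apply/seteqP; split => [Z [p Up <-]|Z OZ] /=.
  by rewrite /tmap base_join; exists (of_ p).1.
by exists (to (tinv j Z)); rewrite /= ?/proj toK ?tinvK//; exact: tinv_dom.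
Qed.

Lemma tchart_overlap j m : overlap (tchart j) (tchart m) = base @^-1` ov j m.
Proof.
apply/seteqP; split => [Z [p [Ujp Ump] <-]|Z OZ] /=.
  by rewrite /tmap base_join; exists (of_ p).1.
have /overlapP[OjZ UmZ] := OZ.
exists (to (tinv j Z)); rewrite /= ?/proj toK ?tinvK//; split => //; exact: tinv_dom.
Qed.

Lemma tchart_transition j m Z : ov j m (base Z) ->
  transition (tchart j) (tchart m) Z = tangent_map (tr j m) Z.
Proof. by move=> oZ; rewrite /transition /= toK tmap_tinv. Qed.

Lemma tchart_is_qchart j : is_qchart (tchart j).
Proof.
have [_ _ Hj _] := Hc; have [_ sO _ _ _] := Hj j.
have sD : smooth_domain (chart_img (tchart j)).
  by rewrite tchart_img; exact: base_smooth_domain.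
split => //.
- exact: tchart_dom_open.
- by move=> p /set_mem Up /=; rewrite tmapK// ofK.
- rewrite continuous_open_subspace; last exact: tchart_dom_open.
  by move=> p /set_mem Up; exact: tchart_cvg.
- rewrite continuous_open_subspace; last by case: sD.
  move=> Z /set_mem; rewrite tchart_img => OZ; exact: tinv_cvg.
Qed.

Lemma qholomorphic_eq (U0 : set X2) (f g : X2 -> X2) : open U0 ->
  (forall z, U0 z -> f z = g z) -> qholomorphic U0 f -> qholomorphic U0 g.
Proof.
move=> oU fg fU z Uz; have [r [P [b psf]]] := fU z Uz.
have /nbhs_ballP[r2 /= r20 Ur2] : nbhs z U0 by exact: open_nbhs_nbhs.
pose r' := Num.min r r2; have r0 : 0 < r by case: psf.
have r'0 : 0 < r' by rewrite lt_min r0.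
have : power_series f z r' P b.
  by apply: power_series_restrict psf => //; rewrite ge_min lexx.
move=> [_ hP Pb cb Pf]; exists r', P, b; split => // y yr.
rewrite -fg; first exact: Pf.
apply: Ur2; rewrite -ball_normE/= opprD addrA subrr add0r normrN.
by rewrite (lt_le_trans yr)// ge_min lexx orbT.
Qed.

Lemma tchart_holomorphic j m : holomorphic_map (overlap (tchart j) (tchart m))
  (transition (tchart j) (tchart m)).
Proof.
have oB : open (base @^-1` ov j m).
  by apply: open_comp (@overlap_open j m) => z _; exact: base_continuous.
rewrite tchart_overlap; split.
  apply: (qholomorphic_eq (f := tangent_map (tr j m))) => //.
    by move=> Z oZ; rewrite tchart_transition.
  apply: tangent_map_holomorphic; [exact: overlap_open|exact: transition_holomorphic].
(* Only [l2H] has the tangent model [l2H], so the smoothness of the original transition maps is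
   available. *)
move=> dl; have d0 : d = l2H by move: dl; case: (d).
apply: (frechet_smooth_eq (f := tangent_map (tr j m))).
  by move=> Z oZ; rewrite tchart_transition.
by apply: tangent_map_smooth; [exact: overlap_open|exact: transition_smooth].
Qed.

Lemma transition_chart (N : metricType R) d' (a b : qchart R N d') :
  {in chart_dom a, cancel (chart_map a) (chart_inv a)} ->
  {in chart_dom b, cancel (chart_map b) (chart_inv b)} ->
  transition a b @` overlap a b = overlap b a /\
  {in overlap a b, cancel (transition a b) (transition b a)}.
Proof.
move=> aK bK; split.
  apply/seteqP; split => [_ [_ [x [ax bx] <-] <-]|_ [x [bx ax] <-]].
    by rewrite /transition /= aK ?mem_set//; exists x.
  exists (chart_map a x); first by exists x.
  by rewrite /transition /= aK ?mem_set.
move=> y /set_mem[x [ax bx] <-].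
by rewrite /transition /= aK ?mem_set// bK ?mem_set.
Qed.

Lemma tchart_biholomorphic j m : biholomorphic
  (overlap (tchart j) (tchart m)) (overlap (tchart m) (tchart j))
  (transition (tchart j) (tchart m)) (transition (tchart m) (tchart j)).
Proof.
have [_ _ Kj _ _] := tchart_is_qchart j; have [_ _ Km _ _] := tchart_is_qchart m.
have [? ?] := transition_chart Kj Km; split => //; exact: tchart_holomorphic.
Qed.

Lemma dense_nbhs (T : topologicalType) (A N : set T) (x : T) :
  dense A -> nbhs x N -> exists2 a, A a & N a.
Proof.
move=> dA; rewrite nbhsE => -[B [oB Bx] BN].
by have [a [Ba Aa]] := dA B (ex_intro _ x Bx) oB; exists a => //; exact: BN.
Qed.

Lemma fib_to j x v : vect (chart_map (tchart j) (to (x, v))) = fib j (x, v).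
Proof. by rewrite /= toK /tmap vect_join. Qed.

Lemma tchart_tangent_bundle :
  tangent_bundle c (T := fun=> (qvect R d : bimodType (quat R))) proj
    (fun x v => to (x, v)) tchart.
Proof.
have fibP j x (v : qvect R d) : fib j (x, v) = transition_der (home x) j x v by [].
have hx := homeP; split.
- by move=> x v w /(congr1 of_); rewrite !toK => -[].
- move=> x; apply/seteqP; split => [_ [v _ <-]|p]; rewrite /= /proj ?toK//.
  move=> <-; exists (of_ p).2 => //.
  by rewrite -[RHS]ofK; congr to; case: (of_ p).
- by [].
- by move=> j x v Ux; rewrite /= toK /tmap base_join.
(* The inverse is the derivative of the reverse transition, by the cocycle relation. *)
- move=> j x Ux; exists (transition_der j (home x) x) => v; rewrite fib_to fibP;
    rewrite transition_der_comp// transition_der_id//.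
- move=> j x u v Ux; rewrite !fib_to !fibP.
  by have := transition_derP (hx x) Ux 1 u v; rewrite !scale1r.
- move=> j x r v Ux; rewrite !fib_to !fibP.
  (* The left side uses the quaternion action on [qvect], the right side the real one on [qspace];
     they agree on real scalars. *)
  have -> : qreal r *: v = r *: (v : X) by apply: ell2P => i /=; rewrite qreal_mull.
  exact: (raw_linearZ (transition_derP (hx x) Ux)).
- move=> j m x v Uj Um; apply: etrans (fib_to m x v) _.
  apply: etrans (esym (transition_der_comp v (hx x) Uj Um)) _.
  exact: (congr1 (transition_der j m x) (esym (fib_to j x v))).
(* In the chart [home x] the fibre coordinate is the identity, and the actions on [qvect] are
   coordinatewise. *)
- move=> x; exists (home x) => // a b v i.
  by rewrite !fib_to !fibP !transition_der_id.
Qed.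

(** Separability is transferred from [M]: the image of a chart contains a ball around [y0], the
    images of the points of [A] approximate each of its points, and integer dilations centred at
    [y0] carry the ball over the whole space. *)
Lemma model_separable (j : J) : exists2 Q : set X, countable Q & dense Q.
Proof.
have [[A cA dA] _ Hj _] := Hc; have [_ [[y0 Oy0] _ _ _] _ _ _] := Hj j.
have /nbhs_ballP[r /= r0 rO] : nbhs y0 (chart_img (c j)).
  by apply: open_nbhs_nbhs; split => //; exact: chart_img_open.
exists (\bigcup_n ((fun a => n%:R *: (phi j a - y0)) @` A)).
  by apply: bigcup_countable => // n _; apply: card_le_trans cA; exact: card_image_le.
move=> O [x Ox] oO.
have /nbhs_ballP[e /= e0 eO] : nbhs x O by exact: open_nbhs_nbhs.
have [n n0 xn] : exists2 n : R, 0 < n & exists k, n = k%:R /\ `|x| < n * r.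
  exists (Num.truncn (`|x| / r)).+1%:R => //; exists (Num.truncn (`|x| / r)).+1; split => //.
  by rewrite -ltr_pdivrMr// truncnS_gt.
case: xn => k [nk xn]; have n0' : n != 0 by rewrite gt_eqF.
(* The target [x], contracted by [n] into the ball around [y0]; precision [e / n] there becomes [e]
   after dilation. *)
pose y := y0 + n^-1 *: x.
have Oy : chart_img (c j) y.
  apply: rO; rewrite -ball_normE/= /y opprD addrA subrr add0r normrN normrZ.
  by rewrite gtr0_norm ?invr_gt0// ltr_pdivrMl.
have [Uy yE] := chart_invP Oy; have phicvg := chart_map_cvg Uy.
have en0 : 0 < e / n by rewrite divr_gt0.
rewrite yE in phicvg.
have [a Aa ay] := dense_nbhs dA
  (@cvgr_dist_lt _ _ _ (nbhs (inv j y)) _ _ _ phicvg _ en0).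
exists (n *: (phi j a - y0)); split; last by exists k => //; exists a => //; rewrite nk.
apply: eO; rewrite -ball_normE/=.
have -> : x - n *: (phi j a - y0) = n *: (y - phi j a).
  by rewrite /y addrAC [in RHS]scalerDr scalerA divff// scale1r [RHS]addrC -scalerN opprB.
by rewrite normrZ gtr0_norm// mulrC -ltr_pdivlMr.
Qed.

(** A point is approximated in its home chart, with the base taken from [A] and the fibre coordinate
    from [Q]. Points of [A] outside a chart domain only add further points to the countable set. *)
Lemma total_separable : exists2 A : set TM, countable A & dense A.
Proof.
have [[j0 _]|nJ] := pselect (exists j : J, True); last first.
  (* Without charts there is no point in the total space. *)
  exists set0; first exact: countable0.
  by move=> O [p _] _; have [j _] := charts_cover (proj p); exfalso; apply: nJ; exists j.
have [Q cQ dQ] := model_separable j0; have [[A cA dA] _ _ _] := Hc.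
exists (\bigcup_(j in [set: J]) \bigcup_(a in A)
  ((fun q => to (tinv j (join (phi j a) q))) @` Q)).
  apply: bigcup_countable => // j _; apply: bigcup_countable => // a _.
  by apply: card_le_trans cQ; exact: card_image_le.
move=> O [p Op] oO; pose j := home (proj p); pose Z := tmap j (of_ p).
have Up : U j (proj p) := homeP _.
have bZ : base Z = phi j (proj p) by rewrite /Z /tmap base_join.
have OZ : chart_img (c j) (base Z) by rewrite bZ; exists (proj p).
have pE : to (tinv j Z) = p by rewrite tmapK// ofK.
have nO : nbhs (to (tinv j Z)) O by rewrite pE; exact: open_nbhs_nbhs.
have /nbhs_ballP[e /= e0 eO] : nbhs Z [set Z' | O (to (tinv j Z'))].
  exact: (tinv_cvg OZ nO).
have e2 : 0 < e / 2 by rewrite divr_gt0.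
have [a Aa aZ] := dense_nbhs dA
  (@cvgr_dist_lt _ _ _ (nbhs (proj p)) _ _ _ (chart_map_cvg Up) _ e2).
have nv : nbhs (vect Z) [set q | `|vect Z - q| < e / 2].
  by apply/nbhs_ballP; exists (e / 2) => // q; rewrite -ball_normE.
have [q Qq qZ] := dense_nbhs dQ nv.
exists (to (tinv j (join (phi j a) q))); split; last by exists j => //; exists a => //; exists q.
apply: eO; rewrite -ball_normE/= -[Z]join_parts -joinN -joinD.
rewrite (le_lt_trans (join_norm _ _))// [ltRHS]splitr ltrD// bZ//.
Qed.

Lemma tchart_manifold : quaternion_manifold tchart.
Proof.
split.
- exact: total_separable.
- apply/seteqP; split => // p _; have [j Uj] := charts_cover (proj p).
  by exists j.
- exact: tchart_is_qchart.
- exact: tchart_biholomorphic.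
Qed.

End TotalSpace.

End Atlas.

Theorem proposition2p1p3p3 (R : realType) (d : model) (M : metricType R)
    (J : countType) (c : J -> qchart R M d) :
  quaternion_manifold c ->
  exists (T : M -> bimodType (quat R)) (TM : metricType R) (proj : TM -> M)
    (iota : forall x, T x -> TM) (tc : J -> qchart R TM (tangent_model d)),
    tangent_bundle c proj iota tc /\ quaternion_manifold tc.
Proof.
move=> Hc.
have [TM [to [of_ [toK ofK distE]]]] :=
  metrize (tdist_xx Hc) (@tdist_pos _ _ _ _ _ Hc) (tdist_sym Hc) (tdist_triangle Hc).
exists (fun=> (qvect R d : bimodType (quat R))), TM, (proj of_).
exists (fun x v => to (x, v)), (tchart Hc to of_); split.
  exact: tchart_tangent_bundle.
exact: tchart_manifold.
Qed.
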